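(* Let $\Bbbk$ be an algebraically closed field of characteristic zero, let $n\ge1$ and $d\ge2$ be integers, and let $\mathcal S_d$ be the space of homogeneous polynomials of degree $d$ in $\Bbbk[x_0,\ldots,x_n]$. Then the general form of $\mathcal S_d$ has strength equal to its slice rank; that is, there is a nonempty Zariski-open subset $U\subseteq\mathcal S_d$ such that $\mathrm{str}(f)=\mathrm{sl.rk}(f)$ for all $f\in U$.
   Context: For $f\in\mathcal S_d$, the strength $\mathrm{str}(f)$ is the minimal integer $r\ge0$ for which there is a decomposition $f=g_1h_1+\ldots+g_rh_r$ where $g_1,h_1,\ldots,g_r,h_r$ are forms (homogeneous polynomials) of positive degree. The slice rank $\mathrm{sl.rk}(f)$ is the minimal integer $r\ge0$ for which there is a decomposition $f=\ell_1h_1+\ldots+\ell_rh_r$ where $\ell_1,\ldots,\ell_r$ are linear forms and $h_1,\ldots,h_r$ are forms of degree $d-1$. *)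

(* Defs.v *)
From Stdlib Require Import ClassicalEpsilon.
From HB Require Import structures.
From mathcomp Require Import all_boot all_order all_algebra.
From mathcomp Require Import mpoly.

Set Implicit Arguments.
Unset Strict Implicit.
Unset Printing Implicit Defensive.

Import GRing.Theory.
Local Open Scope ring_scope.

Section Least.

Definition is_least (P : nat -> Prop) (r : nat) : Prop :=
  P r /\ forall s, P s -> (r <= s)%N.

(* Unspecified when [P] has no witness. *)
Definition least (P : nat -> Prop) : nat := epsilon (inhabits 0%N) (is_least P).

Lemma leastP (P : nat -> Prop) (r : nat) : P r -> is_least P (least P).
Proof.
move=> Pr; apply: epsilon_spec.
elim/ltn_ind: r Pr => r IHr Pr.
case: (excluded_middle_informative (exists2 s, (s < r)%N & P s)) => [[s sr Ps]|no].
  exact: IHr sr Ps.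
exists r; split=> // s Ps; rewrite leqNgt; apply/negP => sr.
by apply: no; exists s.
Qed.

End Least.

Section Rank.

Variables (n : nat) (R : fieldType) (d : nat).

Definition form_of_positive_degree (g : {mpoly R[n]}) : Prop :=
  exists2 e : nat, (0 < e)%N & g \is e.-homog.

Definition strength_decomposition (f : dhomog n R d) (r : nat) : Prop :=
  exists g h : 'I_r -> {mpoly R[n]},
    [/\ forall i, form_of_positive_degree (g i),
        forall i, form_of_positive_degree (h i)
      & (f : {mpoly R[n]}) = \sum_i g i * h i].

Definition slice_decomposition (f : dhomog n R d) (r : nat) : Prop :=
  exists l h : 'I_r -> {mpoly R[n]},
    [/\ forall i, l i \is 1.-homog,
        forall i, h i \is (d.-1).-homog
      & (f : {mpoly R[n]}) = \sum_i l i * h i].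

(* Both are genuine minima as soon as [2 <= d], by [slice_rankP] and
   [strengthP]. *)
Definition strength (f : dhomog n R d) : nat := least (strength_decomposition f).

Definition slice_rank (f : dhomog n R d) : nat := least (slice_decomposition f).

Lemma slice_decomposition_ex (f : dhomog n R d) :
  (0 < d)%N -> slice_decomposition f n.
Proof.
move=> d_gt0; exists (fun i => 'X_i).
suff [h hd ->] : exists2 h : 'I_n -> {mpoly R[n]},
    (forall i, h i \is (d.-1).-homog) &
    (f : {mpoly R[n]}) = \sum_i 'X_i * h i.
  by exists h; split=> // i; rewrite dhomogX /= mdeg1.
have /dhomogP hf := dhomog_is_dhomog f.
rewrite [mpoly_of_dhomog f]mpolyE big_seq.
elim/big_rec: _ => [|m p /hf md [h hd ->]].
  exists (fun=> 0) => [i|]; first exact: dhomog0.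
  by rewrite big1 // => i _; rewrite mulr0.
have [k mk] : exists k, m k != 0%N.
  apply/existsP; rewrite -negb_forall; apply: contraL d_gt0 => /forallP m0.
  by rewrite -md /= mdegE big1 // => i _; apply/eqP.
have dm : m = (U_(k) + (m - U_(k)))%MM by rewrite addmC submK // lep1mP.
exists (fun i => (if i == k then f@_m *: 'X_[m - U_(k)] else 0) + h i) => [i|].
  apply: dhomogD => //; case: eqP => _; last exact: dhomog0.
  by apply: dhomogZ; rewrite dhomogX /= -md /= [in X in _ == X]dm mdegD mdeg1.
rewrite (eq_bigr _ (fun i _ => mulrDr _ _ _)) big_split /=; congr (_ + _).
rewrite (bigD1 k) //= eqxx big1 ?addr0 => [|i /negbTE->]; last by rewrite mulr0.
by rewrite -scalerAr -mpolyXD -dm.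
Qed.

Lemma slice_rankP (f : dhomog n R d) :
  (0 < d)%N -> is_least (slice_decomposition f) (slice_rank f).
Proof. by move=> /(slice_decomposition_ex f); apply: leastP. Qed.

Lemma strengthP (f : dhomog n R d) :
  (2 <= d)%N -> is_least (strength_decomposition f) (strength f).
Proof.
move=> d2; apply: (@leastP _ n).
have [l [h [l1 hd fE]]] := slice_decomposition_ex f (ltnW d2).
exists l, h; split=> // i; first by exists 1%N.
by exists d.-1; first by rewrite -subn1 subn_gt0.
Qed.

End Rank.

Section Zariski.

Variables (K : fieldType) (V : vectType K).

(* The Zariski topology on a vector space does not depend on the basis
   used to define coordinates; [vbasis fullv] is the library's choice. *)
Definition vcoords (v : V) : 'I_(\dim {:V}) -> K :=
  fun i => coord (vbasis {:V}) i v.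

Definition zero_locus (I : {mpoly K[\dim {:V}]} -> Prop) (v : V) : Prop :=
  forall P, I P -> P.@[vcoords v] = 0.

Definition zariski_open (U : V -> Prop) : Prop :=
  exists I : {mpoly K[\dim {:V}]} -> Prop, forall v, U v <-> ~ zero_locus I v.

End Zariski.

(* Main.v *)
(** For d <= 3 every strength decomposition is a slice decomposition. For d >= 4, put
    m = n + 1 - r and N = C(d + m - 1, d); the strength and the slice rank are both
    generically equal to the least r such that N <= r m.

    The map (g, h) |-> g_1 h_1 + ... + g_r h_r has as differential image the degree d
    part of the ideal (g, h), and by the Jacobian criterion it is dominant exactly when
    this is the whole space at some point.

    If N <= r m, take for g_1, ..., g_r some of the variables: it remains to find r forms
    of degree d - 1 in the other m variables whose multiples by linear forms span the
    forms of degree d. A count of the dual forms over a large finite field shows that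
    they exist. The map is then dominant, and by quantifier elimination its image
    contains a nonempty open set.

    If r m < N, let a_i <= d / 2 be the degree of g_i. Fullness of the ideal is an open
    condition, so g may be taken to be a complete intersection, with Hilbert function H
    given by the coefficients of prod_i (1 + t + ... + t^(a_i - 1)) / (1 - t)^m. Adding
    h_i to the ideal fills at most H(a_i) more dimensions in degree d, so it suffices
    that the sum of the H(a_i) is less than H(d). For a_1 = ... = a_r = 1 this says
    r m < N, and raising one maximal a_i at a time preserves it. The only exception is
    the sum of two products of quadrics in four variables, where the four quadrics
    form a complete intersection, which is not full in degree 4. *)

From HB Require Import structures.
Require Import Defs.
From mathcomp Require Import all_boot all_order all_algebra all_field.
From mathcomp Require Import mpoly.
From mathcomp Require Import zify.

Set Implicit Arguments.
Unset Strict Implicit.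
Unset Printing Implicit Defensive.

(** * Hilbert functions of complete intersections *)

(* [delay f k i] is the coefficient of [t^k] in [t^i * \sum_j f j * t^j]. *)
Definition delay (f : nat -> nat) k i := if i <= k then f (k - i) else 0.

(* Hilbert function of a complete intersection of type [l] and dimension [m]: the
   coefficient of [t^k] in [\prod_(a <- l) (1 + t + ... + t^(a-1)) / (1 - t)^m]. *)
Fixpoint ci_hilb m (l : seq nat) k :=
  if l is a :: l' then \sum_(i < a) delay (ci_hilb m l') k i else 'C(k + m - 1, k).

#[global] Arguments ci_hilb : simpl never.

Lemma delayE f k i : delay f k i = if i <= k then f (k - i) else 0.
Proof. by []. Qed.

Lemma delay0 f k : delay f k 0 = f k.
Proof. by rewrite /delay subn0. Qed.

Lemma delay_gt f k i : k < i -> delay f k i = 0.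
Proof. by rewrite /delay ltnNge => /negbTE->. Qed.

Lemma ci_hilb_nil m k : ci_hilb m [::] k = 'C(k + m - 1, k).
Proof. by []. Qed.

Lemma ci_hilb_consE m a l k : ci_hilb m (a :: l) k = \sum_(i < a) delay (ci_hilb m l) k i.
Proof. by []. Qed.

Lemma ci_hilb_consS m a l k : ci_hilb m (a.+1 :: l) k = ci_hilb m (a :: l) k + delay (ci_hilb m l) k a.
Proof. exact: big_ord_recr. Qed.

Lemma ci_hilb_cons0 m l k : ci_hilb m (0 :: l) k = 0.
Proof. exact: big_ord0. Qed.

Lemma ci_hilb_cons1 m l k : ci_hilb m (1 :: l) k = ci_hilb m l k.
Proof. by rewrite ci_hilb_consS ci_hilb_cons0 delay0. Qed.

(** Coefficients of [1 + t + ... + t^a = 1 + t (1 + ... + t^(a-1))]. *)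
Lemma ci_hilb_cons_diag m a l k : ci_hilb m (a.+1 :: l) k.+1 = ci_hilb m l k.+1 + ci_hilb m (a :: l) k.
Proof. by rewrite !ci_hilb_consE big_ord_recl delay0; congr (_ + _); apply: eq_bigr. Qed.

Lemma ci_hilb_varS0 m l : ci_hilb m.+1 l 0 = ci_hilb m l 0.
Proof.
elim: l => [|a l IH]; first by rewrite !ci_hilb_nil !bin0.
by rewrite !ci_hilb_consE; apply: eq_bigr => i _; rewrite !delayE sub0n IH.
Qed.

(** Multiplying the series for [m.+1] by [1 - t] gives the series for [m]. *)
Lemma ci_hilb_varS m l k : ci_hilb m.+1 l k.+1 = ci_hilb m.+1 l k + ci_hilb m l k.+1.
Proof.
elim: l k => [|a l IH] k.
  by rewrite !ci_hilb_nil !addSn !addnS !subSS !subn0 binS addnC.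
rewrite !ci_hilb_consE -big_split; apply: eq_bigr => i _.
rewrite !delayE; case: (ltngtP i k.+1) => ik; last by rewrite ik subnn ltnn ci_hilb_varS0.
  by rewrite -ltnS ik subSn // IH.
by rewrite leqNgt (ltn_trans (ltnSn k) ik).
Qed.

(** Since [(1 + ... + t^(a-1)) / (1 - t)^m = (1 - t^a) / (1 - t)^(m+1)], this is the effect on the
    Hilbert function of cutting by a regular form of degree [a]. *)
Lemma ci_hilb_cut m a l k : ci_hilb m.+1 l k = ci_hilb m (a :: l) k + delay (ci_hilb m.+1 l) k a.
Proof.
elim: a => [|a IH]; first by rewrite ci_hilb_cons0 delay0.
rewrite ci_hilb_consS -addnA IH; congr (_ + _); rewrite !delayE.
have [ak|ak|->] := ltngtP a k; [|by []|by rewrite subnn ci_hilb_varS0 addn0].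
have [j jE] : exists j, k - a = j.+1 by exists (k - a).-1; lia.
by rewrite subnS jE ci_hilb_varS addnC.
Qed.

Lemma ci_hilb_swap m a b l k : ci_hilb m (a :: b :: l) k = ci_hilb m (b :: a :: l) k.
Proof.
have E a' b' : ci_hilb m (a' :: b' :: l) k = \sum_(i < a') \sum_(j < b') delay (ci_hilb m l) k (i + j).
  rewrite ci_hilb_consE; apply: eq_bigr => i _; rewrite {1}delayE; case: leqP => ik; last first.
    by rewrite big1 // => j _; rewrite delay_gt // ltn_addr.
  by apply: eq_bigr => j _; rewrite !delayE leq_subRL // subnDA.
by rewrite !E exchange_big; apply: eq_bigr => i _; apply: eq_bigr => j _; rewrite addnC.
Qed.

Lemma eq_ci_hilb_cons m a l1 l2 : ci_hilb m l1 =1 ci_hilb m l2 -> ci_hilb m (a :: l1) =1 ci_hilb m (a :: l2).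
Proof. by move=> e k; rewrite !ci_hilb_consE; apply: eq_bigr => i _; rewrite !delayE e. Qed.

Lemma ci_hilb_perm m l1 l2 : perm_eq l1 l2 -> ci_hilb m l1 =1 ci_hilb m l2.
Proof.
elim: l1 l2 => [|a l1 IH] l2 p.
  by have := perm_size p; case: l2 {p}.
have al2 : a \in l2 by rewrite -(perm_mem p) mem_head.
case/splitPr: al2 p => s t p.
have /IH e : perm_eq l1 (s ++ t).
  by move: p; rewrite perm_sym -cat1s perm_catCA /= perm_cons perm_sym.
move=> k {p}.
rewrite (eq_ci_hilb_cons a e); elim: s {IH e} k => // b s IHs k.
rewrite !cat_cons.
by rewrite ci_hilb_swap; apply: eq_ci_hilb_cons.
Qed.

Lemma ci_hilb_leq m l j k : 0 < m -> j <= k -> ci_hilb m l j <= ci_hilb m l k.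
Proof.
case: m => [|m] // _; elim: k => [|k IH]; first by rewrite leqn0 => /eqP->.
rewrite leq_eqVlt ltnS => /predU1P[->|/IH h]; first exact: leqnn.
by rewrite ci_hilb_varS; apply: leq_trans h _; exact: leq_addr.
Qed.

Lemma ci_hilb_0 m l : all (leq 1) l -> ci_hilb m l 0 = 1.
Proof.
elim: l => [|[|a] l IH] //; first by rewrite ci_hilb_nil bin0.
by move=> /IH h; rewrite ci_hilb_consE big_ord_recl delay0 h big1 // => i _; rewrite delay_gt.
Qed.

Lemma ci_hilb_1 m l : all (leq 1) l -> ci_hilb m l 1 = m + count (leq 2) l.
Proof.
elim: l => [|[|[|a]] l IH] //; first by rewrite ci_hilb_nil bin1 /=; lia.
  by move=> /IH h; rewrite ci_hilb_cons1 h.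
move=> al; have /IH h : all (leq 1) l by [].
have h0 : ci_hilb m (a.+1 :: l) 0 = 1 by apply: ci_hilb_0.
by rewrite ci_hilb_cons_diag h h0 /=; lia.
Qed.

(** The extra term [t^a] in the first factor contributes the coefficient at [x - a]: nothing for
    [x < a], the value 1 for [x = a], and [ci_hilb m l 1] for [x = a.+1]. No entry of [s] is
    larger. *)
Lemma sum_ci_hilb_consS m l a s : all (leq 1) l -> all (geq a.+1) s ->
  \sum_(x <- s) ci_hilb m (a.+1 :: l) x =
  \sum_(x <- s) ci_hilb m (a :: l) x + ci_hilb m l 1 * count_mem a.+1 s + count_mem a s.
Proof.
move=> l1 sa.
transitivity (\sum_(x <- s) (ci_hilb m (a :: l) x + delay (ci_hilb m l) x a)).
  by apply: eq_bigr => y _; rewrite ci_hilb_consS.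
rewrite big_split /= -addnA; congr (_ + _).
elim: s sa => [|y s IH] /=; first by rewrite big_nil muln0.
case/andP=> ya /IH sa; rewrite big_cons sa delayE.
case: (ltngtP y a) => yay.
- have -> : (y == a.+1) = false by lia.
  lia.
- have yE : y = a.+1 by lia.
  by rewrite yE eqxx subSnn; lia.
- have -> : (y == a.+1) = false by lia.
  by rewrite yay subnn ci_hilb_0 //; lia.
Qed.

Section Step.
Variables (d m : nat).

Definition excess_pos l := \sum_(x <- l) ci_hilb m l x < ci_hilb m l d.

(** When the head is raised from [a] to [a.+1], the sum in [excess_pos] grows by the left side of
    the displayed inequality, and the value in degree [d] grows by its right side. *)
Lemma excess_step a l : all (leq 1) l -> all (geq a.+1) l -> a <= d ->
  ci_hilb m l a.+1 + ci_hilb m l 1 * count_mem a.+1 l + count_mem a l <= ci_hilb m l (d - a) ->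
  excess_pos (a :: l) -> excess_pos (a.+1 :: l).
Proof.
move=> l1 la ad h; rewrite /excess_pos !big_cons sum_ci_hilb_consS //.
rewrite ci_hilb_cons_diag [ci_hilb m (a.+1 :: l) d]ci_hilb_consS delayE ad.
lia.
Qed.

Lemma excess_perm l l' : perm_eq l l' -> excess_pos l -> excess_pos l'.
Proof.
move=> p; rewrite /excess_pos (ci_hilb_perm m p) -(perm_big _ p) /=.
by under eq_bigr => x _ do rewrite (ci_hilb_perm m p).
Qed.
End Step.

(** * Numerical estimates for raising one degree *)

Lemma bin2_double u : 'C(u, 2) * 2 + u = u * u.
Proof. by elim: u => // u IH; rewrite binS bin1; lia. Qed.

(* Expansion of [(1 + t)^u / (1 - t)^m]. *)
Lemma ci_hilb_le2 m l : all (pred2 1 2) l -> let u := count_mem 2 l in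
  let B k := 'C(k + m - 1, k) in
  [/\ ci_hilb m l 1 = B 1 + u, ci_hilb m l 2 = B 2 + u * B 1 + 'C(u, 2)
    & forall k, B k.+1 + u * B k <= ci_hilb m l k.+1 /\
      B k.+2 + u * B k.+1 + 'C(u, 2) * B k <= ci_hilb m l k.+2].
Proof.
move=> l12; have l1 : all (leq 1) l.
  by apply: sub_all l12 => x /pred2P[]->.
move=> u B; have B0 : B 0 = 1 by rewrite /B bin0.
rewrite {}/u; elim: l l12 l1 => [|a l IH] /=.
  by split=> [||k]; rewrite ?bin0n !ci_hilb_nil -!/(B _) !(addn0, mul0n).
case/andP=> /pred2P[]-> l12 l1; have /= [h1 h2 h3] := IH l12 l1.
  split=> [||k]; rewrite !ci_hilb_cons1 ?add0n //; exact: h3.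
have E k : ci_hilb m (2 :: l) k.+1 = ci_hilb m l k.+1 + ci_hilb m l k by rewrite ci_hilb_cons_diag ci_hilb_cons1.
rewrite binS bin1; split=> [||k]; rewrite ?E ?h2 ?h1 ?ci_hilb_0 //=; [lia|lia|].
have [h4 h5] := h3 k; case: k h4 h5 => [|k] h4 h5.
  by rewrite ci_hilb_0 // B0 in h4 h5 *; split; nia.
by have [h6 h7] := h3 k; split; nia.
Qed.

Lemma bin2_fact n : 'C(n.+1, 2) * 2 = n.+1 * n.
Proof. by have := bin2_double n.+1; nia. Qed.

Lemma bin3_fact n : 'C(n.+2, 3) * 6 = n.+2 * n.+1 * n.
Proof.
have := mul_bin_diag n.+2 2; have := bin2_fact n; rewrite /=; nia.
Qed.

Lemma bin4_fact n : 'C(n.+3, 4) * 24 = n.+3 * n.+2 * n.+1 * n.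
Proof.
have := mul_bin_diag n.+3 3; have := bin3_fact n; rewrite /=; nia.
Qed.

(** Serves to prove [f3] in [excess_first], after multiplication by [m]. Induction on [d] with [m]
    fixed, starting from [d = 4] if [m >= 3] and from [d = 5] if [m = 2]. *)
Lemma binom_gap d m : 4 <= d -> 2 <= m -> (d != 4) || (m != 2) ->
  m * 'C(2 + m - 1, 2) + 'C(d + m - 1, d) <= m * 'C(d.-1 + m - 1, d.-1) + m + 1.
Proof.
case: m => [|[|m]] // d4 _.
(* When [d] goes up by one, the left side gains at most as much as the right side. *)
have mono k : 'C(k.+2 + m.+2 - 1, k.+2) + m.+2 * 'C(k + m.+2 - 1, k) <=
   m.+2 * 'C(k.+1 + m.+2 - 1, k.+1) + 'C(k.+1 + m.+2 - 1, k.+1).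
  have -> : k.+2 + m.+2 - 1 = (k + m).+3 by lia.
  have -> : k.+1 + m.+2 - 1 = (k + m).+2 by lia.
  have -> : k + m.+2 - 1 = (k + m).+1 by lia.
  rewrite (binS (k + m).+2 k.+1).
  have h1 := mul_bin_diag (k + m).+2 k.+1; rewrite /= in h1.
  have h2 := binS (k + m).+1 k.
  have h3 : 'C((k + m).+2, k.+2) <= m.+2 * 'C((k + m).+1, k.+1).
    rewrite -(leq_pmul2l (ltn0Sn k.+1)) -h1 mulnA leq_mul2r; apply/orP; right; nia.
  nia.
have H d0 : m.+2 * 'C(2 + m.+2 - 1, 2) + 'C(d0.+1 + m.+2 - 1, d0.+1) <= m.+2 * 'C(d0 + m.+2 - 1, d0) + m.+2 + 1 ->
   forall j, m.+2 * 'C(2 + m.+2 - 1, 2) + 'C((d0 + j).+1 + m.+2 - 1, (d0 + j).+1) <= m.+2 * 'C(d0 + j + m.+2 - 1, d0 + j) + m.+2 + 1.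
  move=> h; elim=> [|j IH]; first by rewrite addn0.
  by have := mono (d0 + j); rewrite [d0 + j.+1]addnS; lia.
case: m mono H => [|m] mono H ne.
  have -> : d = (4 + (d - 5)).+1 by lia.
  by apply: H.
have -> : d = (3 + (d - 4)).+1 by lia.
apply: H.
have -> : 2 + m.+3 - 1 = m.+4 by lia.
have -> : 4 + m.+3 - 1 = m.+4.+2 by lia.
have -> : 3 + m.+3 - 1 = m.+4.+1 by lia.
have := bin4_fact m.+3; have := bin3_fact m.+3; have := bin2_fact m.+3; nia.
Qed.

Lemma binom_mono m j k : 0 < m -> j <= k -> 'C(j + m - 1, j) <= 'C(k + m - 1, k).
Proof. by move=> m0 jk; rewrite -!(ci_hilb_nil m) ci_hilb_leq. Qed.

(** The condition of [excess_step] for raising a 1 to a 2. With [u] entries 2, [v] entries 1 and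
    [B k = C(k + m - 1, k)], the identity [u^2 = 2 C(u,2) + u] turns the left side into
    [(B 2 + u + v) + 2 m u + 3 C(u,2)], while the right side is at least
    [B (d-1) + u B (d-2) + C(u,2) B (d-3)]. The facts [f3], [f2], [f1] compare these term by
    term. *)
Lemma excess_first d m l : 4 <= d -> 2 <= m -> (d != 4) || (m != 2) ->
  all (pred2 1 2) l -> (size l).+1 * m < 'C(d + m - 1, d) ->
  ci_hilb m l 2 + ci_hilb m l 1 * count_mem 2 l + count_mem 1 l <= ci_hilb m l d.-1.
Proof.
move=> d4 m2 ne l12 lt; have [h1 h2 h3] := ci_hilb_le2 m l12.
have gap := binom_gap d4 m2 ne.
have szE : size l = count_mem 2 l + count_mem 1 l.
  by elim: l l12 {h1 h2 h3 lt} => //= a l IH /andP[/pred2P[]-> /IH->] /=; lia.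
case: d d4 ne lt gap => [|[|[|[|d]]]] // d4 ne lt gap.
have [_ h4] := h3 d.+1; rewrite [_.+4.-1]/= h1 h2.
rewrite szE in lt; set u := count_mem 2 l in h1 h2 h4 lt *; set v := count_mem 1 l in lt *.
rewrite bin1 in h1 h2 h4 *.
have f1 : 3 <= 'C(d.+1 + m - 1, d.+1).
  case: m m2 ne {lt gap h1 h2 h3 h4} => [|[|[|m]]] // _ ne.
    by apply: (@leq_trans ('C(2 + 2 - 1, 2))) => //; apply: binom_mono => //; lia.
  by apply: (@leq_trans ('C(1 + m.+3 - 1, 1))); [rewrite bin1; lia|apply: binom_mono].
have f2 : 2 * m <= 'C(d.+2 + m - 1, d.+2).
  case: m m2 ne {lt gap h1 h2 h3 h4 f1} => [|[|[|m]]] // _ ne.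
    by apply: (@leq_trans ('C(3 + 2 - 1, 3))) => //; apply: binom_mono => //; lia.
  apply: (@leq_trans ('C(2 + m.+3 - 1, 2))); last by apply: binom_mono.
  have -> : 2 + m.+3 - 1 = m.+4 by lia.
  by have := bin2_fact m.+3; nia.
have f3 : 'C(2 + m - 1, 2) + u + v <= 'C(d.+3 + m - 1, d.+3).
  rewrite [_.+4.-1]/= in gap.
  rewrite -(leq_pmul2l (n1 := _) (ltnW m2)); nia.
have := bin2_double u; nia.
Qed.

(** Crude bounds by induction on [l] that see only how many entries are at least 2 and at least 3;
    the one in degree 4 is quadratic in these counts, which is what [excess_next] consumes. *)
Lemma ci_hilb_lower s l : 0 < s -> all (leq 1) l ->
  let q := count (leq 2) l in let u := count (leq 3) l in
  [/\ s + q <= ci_hilb s l 1, s + q + u <= ci_hilb s l 2 &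
   1 + q + 'C(q, 2) + s.-1 * u + u * q + 'C(u, 2) <= ci_hilb s l 4].
Proof.
case: s => // s _; elim: l => [|a l IH] /=.
  rewrite !ci_hilb_nil !muln0 !addn0; split.
  - by rewrite bin1; lia.
  - have -> : 2 + s.+1 - 1 = s.+2 by lia.
    by rewrite binS bin1; lia.
  - by rewrite bin_gt0; lia.
case/andP=> a1 l1; have /= [h1 h2 h4] := IH l1.
have h12 : ci_hilb s.+1 l 1 <= ci_hilb s.+1 l 2 by apply: ci_hilb_leq.
have h23 : ci_hilb s.+1 l 2 <= ci_hilb s.+1 l 3 by apply: ci_hilb_leq.
have h0 := ci_hilb_0 s.+1 l1.
case: a a1 => [|[|a]] // _; first by rewrite !ci_hilb_cons1.
have E1 c : ci_hilb s.+1 (c.+2 :: l) 1 = ci_hilb s.+1 l 1 + 1.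
  by rewrite ci_hilb_cons_diag ci_hilb_0.
case: a => [|a].
  have E k : ci_hilb s.+1 (2 :: l) k.+1 = ci_hilb s.+1 l k.+1 + ci_hilb s.+1 l k by rewrite ci_hilb_cons_diag ci_hilb_cons1.
  rewrite !E h0 /= !add0n binS bin1; split; nia.
have E2 : ci_hilb s.+1 (a.+3 :: l) 2 = ci_hilb s.+1 l 2 + ci_hilb s.+1 (a.+2 :: l) 1 by rewrite ci_hilb_cons_diag.
have E3 k : ci_hilb s.+1 l k.+2 + ci_hilb s.+1 l k.+1 + ci_hilb s.+1 l k <= ci_hilb s.+1 (a.+3 :: l) k.+2.
  by rewrite !ci_hilb_cons_diag addnA leq_add2l ci_hilb_consE big_ord_recl delay0 leq_addr.
have := E3 2; have := E3 0; rewrite E2 !E1 h0 /= ?add1n !binS !bin1; split; nia.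
Qed.

(** The condition of [excess_step] for raising an entry [a >= 2]. As [d - a >= a + 2], the right
    side exceeds [ci_hilb m l a.+1] by at least [ci_hilb m.-1 l a.+2], hence by at least
    [ci_hilb m.-1 l 4], which dominates the counting terms. *)
Lemma excess_next d m a l : 2 <= m -> 2 <= a -> 2 * a.+1 <= d ->
  all (leq 1) l ->
  ci_hilb m l a.+1 + ci_hilb m l 1 * count_mem a.+1 l + count_mem a l <= ci_hilb m l (d - a).
Proof.
case: m => [|[|s]] // _ a2 ad l1.
apply: (@leq_trans (ci_hilb s.+2 l a.+2)); last by apply: ci_hilb_leq => //; lia.
rewrite [ci_hilb _ l a.+2]ci_hilb_varS -addnA leq_add2l.
apply: (@leq_trans (ci_hilb s.+1 l 4)); last by apply: ci_hilb_leq.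
have /= [_ _ h4] := ci_hilb_lower (ltn0Sn s) l1; rewrite ci_hilb_1 //.
set q := count _ l in h4 *; set u3 := count _ l in h4.
set u := count_mem a.+1 l; set v := count_mem a l.
have uu3 : u <= u3 by apply: sub_count => x /= /eqP->.
have uvq : u + v <= q.
  rewrite /u /v /q; elim: (l) => //= x s0; lia.
have := bin2_double u; have := bin2_double q; have := bin2_double u3.
have : 'C(u, 2) <= 'C(u3, 2) by apply: leq_bin2l.
have : 'C(u + v, 2) <= 'C(q, 2) by apply: leq_bin2l.
have : 'C(u, 2) <= 'C(u + v, 2) by apply: leq_bin2l; lia.
have : u * q <= u3 * q by rewrite leq_mul2r uu3 orbT.
have : s * u <= s * u3 by rewrite leq_mul2l uu3 orbT.
have : u <= 1 + 'C(u, 2) by case: (u) => [|[|n]] //; rewrite binS bin1; lia.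
nia.
Qed.

(* Induction on the sum of [l], lowering a maximal entry by one. The exception has
   excess exactly zero. *)
Theorem ci_hilb_excess d m l : 4 <= d -> 2 <= m ->
  all (leq 1) l -> all (fun a => 2 * a <= d) l -> size l * m < 'C(d + m - 1, d) ->
  excess_pos d m l \/ [/\ d = 4, m = 2 & l = [:: 2; 2]].
Proof.
move=> d4 m2; have [/andP[/eqP-> /eqP->]|] := boolP ((d == 4) && (m == 2)).
  (* Here [2 * size l < 5] and all entries are 1 or 2, which leaves seven lists to inspect. *)
  move=> l1 l2 sz; have {sz}: size l <= 2.
    by move: sz; have -> : 'C(4 + 2 - 1, 4) = 5 by []; lia.
  have C : excess_pos 4 2 [::] /\ excess_pos 4 2 [:: 1] /\ excess_pos 4 2 [:: 2] /\
     excess_pos 4 2 [:: 1; 1] /\ excess_pos 4 2 [:: 1; 2] /\ excess_pos 4 2 [:: 2; 1].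
    rewrite /excess_pos !big_cons !big_nil.
    rewrite !ci_hilb_consE !big_ord_recl !big_ord0 !delayE /= !ci_hilb_consE !big_ord_recl !big_ord0 !delayE /= !ci_hilb_nil.
    by vm_compute.
  case: l l1 l2 => [|a [|b [|? ?]]] //=.
  - by left; case: C.
  - move=> /andP[a1 _] /andP[a2 _] _; left.
    have [->|->] : a = 1 \/ a = 2 by lia.
      by tauto.
    by tauto.
  move=> /and3P[a1 b1 _] /and3P[a2 b2 _] _.
  have [->|->] : a = 1 \/ a = 2 by lia.
    have [->|->] : b = 1 \/ b = 2 by lia.
      by tauto.
    by tauto.
  have [->|->] : b = 1 \/ b = 2 by lia.
    by tauto.
  by right.
rewrite negb_and => ne l1 l2 sz; left.
have [k] := ubnP (sumn l); elim: k l l1 l2 sz => // k IH l l1 l2 sz lk.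
have [all1|] := boolP (all (pred1 1) l).
  rewrite /excess_pos; have -> : l = nseq (size l) 1 by apply/all_pred1P.
  have E j : ci_hilb m (nseq (size l) 1) j = ci_hilb m [::] j.
    by elim: (size l) => //= i IHi; rewrite ci_hilb_cons1.
  rewrite E; under eq_bigr => x _ do rewrite E.
  rewrite big_nseq ci_hilb_nil; move: sz; rewrite bin1.
  have -> : iter (size l) (addn (1 + m - 1)) 0 = size l * m.
    by elim: (size l) => //= i ->; lia.
  by [].
rewrite -has_predC => /hasP[x0 x0l x01].
have [x xl xmax] : exists2 x, x \in l & all (geq x) l.
  have [i il imax] : exists2 i, i \in l & {in l, forall y, y <= i}.
    elim: (l) x0 x0l {x01} => // y s IHs x0 _.
    case: s IHs => [|z s] IHs; first by exists y; rewrite ?mem_head // => w; rewrite inE => /eqP->.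
    have [i is_ ih] := IHs z (mem_head _ _).
    have [yi|iy] := leqP y i.
      by exists i; [rewrite inE is_ orbT|move=> w; rewrite inE => /orP[/eqP->|/ih]].
    exists y; first exact: mem_head.
    move=> w; rewrite inE => /orP[/eqP->//|/ih wi]; lia.
  by exists i => //; apply/allP => y yl; apply: imax.
have x2 : 2 <= x.
  move/allP: xmax => /(_ _ x0l) /=; move/allP: l1 => /(_ _ x0l); move: x01 => /=; lia.
have := perm_to_rem xl; move: (rem x l) => l' p.
apply: excess_perm (_ : perm_eq (x :: l') l) _; first by rewrite perm_sym.
have l1' : all (leq 1) l' by move: l1; rewrite (perm_all _ p) /= => /andP[].
have l2' : all (fun a => 2 * a <= d) l' by move: l2; rewrite (perm_all _ p) /= => /andP[].
have xd : 2 * x <= d by move: l2; rewrite (perm_all _ p) /= => /andP[].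
have xmax' : all (geq x) l' by move: xmax; rewrite (perm_all _ p) /= => /andP[].
have szE : size l = (size l').+1 by rewrite (perm_size p).
have sumE : sumn l = x + sumn l' by rewrite (perm_sumn p).
case: x x2 {xl xmax} p xd xmax' sumE => [|[|a]] // _ p xd xmax' sumE.
apply: excess_step => //; first lia; last first.
  apply: IH => /=; rewrite ?l1' ?l2' ?andbT -?szE //; lia.
case: a p xd xmax' sumE => [|a] p xd xmax' sumE.
  rewrite subn1; apply: excess_first => //; last by rewrite -szE.
  by apply/allP => y yl'; move/allP: l1' => /(_ _ yl'); move/allP: xmax' => /(_ _ yl') /=; lia.
exact: excess_next.
Qed.

Import GRing.Theory.
Local Open Scope ring_scope.

(** * The Jacobian criterion *)

Definition msubst (K : fieldType) N M (F : 'I_N -> {mpoly K[M]}) (Q : {mpoly K[N]}) : {mpoly K[M]} :=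
  Q \mPo [tuple F i | i < N].

Section Subst.
Variables (K : fieldType) (N M : nat) (F : 'I_N -> {mpoly K[M]}).

HB.instance Definition _ := GRing.Linear.copy (msubst F) (comp_mpoly [tuple F i | i < N]).
HB.instance Definition _ := GRing.RMorphism.copy (msubst F) (comp_mpoly [tuple F i | i < N]).

Lemma msubstX m : msubst F 'X_[m] = \prod_i F i ^+ m i.
Proof. by rewrite /msubst comp_mpolyX; apply: eq_bigr => i _; rewrite tnth_mktuple. Qed.

Lemma msubstU i : msubst F 'X_i = F i.
Proof. by rewrite /msubst comp_mpolyXU -tnth_nth tnth_mktuple. Qed.

Lemma msubstC c : msubst F c%:MP = c%:MP.
Proof. exact: comp_mpolyC. Qed.

Lemma meval_msubst v Q : (msubst F Q).@[v] = Q.@[fun i => (F i).@[v]].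
Proof. by rewrite /msubst comp_mpoly_meval; apply: meval_eq => i; rewrite tnth_mktuple. Qed.

Lemma mpoly_alg_ind n (P : {mpoly K[n]} -> Prop) :
  (forall c, P c%:MP) -> (forall i, P 'X_i) ->
  (forall p q, P p -> P q -> P (p + q)) -> (forall p q, P p -> P q -> P (p * q)) ->
  forall p, P p.
Proof.
move=> PC PX PD PM p; rewrite [p]mpolyE; apply: big_ind => [|x y|m _]; first by rewrite -mpolyC0.
  exact: PD.
rewrite -mul_mpolyC; apply: (PM) => //.
rewrite mpolyXE_id; apply: big_ind => [|x y|i _]; first by rewrite -mpolyC1.
  exact: (PM).
by elim: (m i) => [|k IH]; rewrite ?expr0 -?mpolyC1 // exprS; exact: (PM).
Qed.

Lemma mderiv_msubst j Q :
  (msubst F Q)^`M(j) = \sum_i msubst F (Q^`M(i)) * (F i)^`M(j).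
Proof.
elim/mpoly_alg_ind: Q => [c|i|p q IHp IHq|p q IHp IHq].
- by rewrite msubstC mderivC big1 // => i _; rewrite mderivC raddf0 mul0r.
- rewrite msubstU (bigD1 i) //= mderivX mnm1E eqxx scale1r.
  rewrite -[X in 'X_[X - _]]addm0 addmC addmK mpolyX0 rmorph1 mul1r big1 ?addr0 // => k ki.
  by rewrite mderivX mnm1E eq_sym (negbTE ki) scale0r raddf0 mul0r.
- rewrite raddfD mderivD IHp IHq -big_split /=; apply: eq_bigr => i _.
  by rewrite mderivD raddfD mulrDl.
- rewrite rmorphM mderivM IHp IHq mulr_suml mulr_sumr -big_split /=.
  by apply: eq_bigr => i _; rewrite mderivM raddfD /= !rmorphM mulrDl mulrAC mulrA.
Qed.
End Subst.

Lemma msubst_comp (K : fieldType) N M P (F : 'I_N -> {mpoly K[M]}) (G : 'I_P -> {mpoly K[N]}) Q :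
  msubst F (msubst G Q) = msubst (fun i => msubst F (G i)) Q.
Proof.
elim/mpoly_alg_ind: Q => [c|i|p q IHp IHq|p q IHp IHq].
- by rewrite !msubstC.
- by rewrite !msubstU.
- by rewrite !raddfD /= IHp IHq.
- by rewrite !rmorphM /= IHp IHq.
Qed.

Lemma eq_msubst (K : fieldType) N M (F G : 'I_N -> {mpoly K[M]}) Q : F =1 G -> msubst F Q = msubst G Q.
Proof. by move=> FG; rewrite /msubst; congr comp_mpoly; apply: eq_from_tnth => i; rewrite !tnth_mktuple. Qed.

Section Eval.
Variables (K : fieldType) (charK0 : [pchar K] =i pred0).


Lemma natf_eq0 n : (n%:R == 0 :> K) = (n == 0)%N.
Proof. by move/pcharf0P: charK0. Qed.

(** In characteristic zero the elements [0, 1, ..., size q - 1] are distinct, and they outnumber the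
    roots of [q]. *)
Lemma poly_nonroot (q : {poly K}) : q != 0 -> exists x, ~~ root q x.
Proof.
move=> q0; pose s := [seq n%:R : K | n <- iota 0 (size q)].
have us : uniq s.
  rewrite map_inj_uniq ?iota_uniq // => m n /eqP.
  wlog mn : m n / (m <= n)%N => [W|].
    by case/orP: (leq_total m n) => h e; [|symmetry]; apply: W; rewrite // eq_sym.
  rewrite eq_sym -subr_eq0 -natrB // natf_eq0 subn_eq0 => nm.
  by apply/eqP; rewrite eqn_leq mn.
case: (boolP (all (root q) s)) => [h|/allPn[x _ hx]]; last by exists x.
by have := max_poly_roots q0 h us; rewrite size_map size_iota ltnn.
Qed.

(** Induction on [n]: view [p] through [muni] as a polynomial in the last variable, specialize the
    other variables where one coefficient survives, then choose a nonroot. *)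
Lemma mpoly_nonroot n (p : {mpoly K[n]}) : p != 0 -> exists v, p.@[v] != 0.
Proof.
elim: n p => [|n IHn] p p0.
  exists (fun=> 0); rewrite (nvar0_mpolyC p) mevalC.
  by apply: contra p0 => /eqP h; rewrite (nvar0_mpolyC p) h mpolyC0.
have mp0 : muni p != 0.
  apply: contra p0 => /eqP mp0; apply/eqP/mpolyP => m; rewrite mcoeff0.
  have /(congr1 (fun q : {poly {mpoly K[n]}} => q`_(m ord_max)@_[multinom m (widen_ord (leqnSn n) i) | i < n])) := mp0.
  rewrite muniE coef0 mcoeff0 coef_sum raddf_sum /=.
  have [mp|mp] := boolP (m \in msupp p); last by rewrite memN_msupp_eq0.
  rewrite (bigD1_seq m) ?msupp_uniq //= coefZ coefXn eqxx mulr1 mcoeffZ mcoeffX.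
  rewrite eqxx mulr1 big1 ?addr0 // => m' m'm.
  rewrite coefZ coefXn; case: eqP => [e1|]; last by rewrite mulr0 mcoeff0.
  rewrite mulr1 mcoeffZ mcoeffX; case: eqP => [e2|]; last by rewrite mulr0.
  case/eqP: m'm; apply/mnmP => i; case: (unliftP ord_max i) => [j ->|->//].
  have /mnmP/(_ j) := e2; rewrite !mnmE => h.
  have -> : lift ord_max j = widen_ord (leqnSn n) j by apply: val_inj; rewrite /= /bump leqNgt ltn_ord.
  by [].
have [k pk] : exists k, (muni p)`_k != 0.
  by exists (size (muni p)).-1; rewrite -lead_coefE lead_coef_eq0.
have [v hv] := IHn _ pk.
pose q := map_poly (meval v) (muni p).
have q0 : q != 0.
  by apply: contra hv => /eqP h; have := congr1 (fun q : {poly K} => q`_k) h; rewrite coef_map coef0 => /eqP.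
have [x hx] := poly_nonroot q0.
pose w (i : 'I_n.+1) := if unlift ord_max i is Some j then v j else x.
exists w; suff -> : p.@[w] = q.[x] by [].
rewrite /q muniE raddf_sum horner_sum mevalE; apply: eq_bigr => m _.
rewrite /= map_polyZ hornerZ map_polyXn hornerXn /= mevalZ mevalX -mulrA; congr (_ * _).
rewrite big_ord_recr /=; congr (_ * _); last by rewrite /w unlift_none.
apply: eq_bigr => i _; rewrite mnmE.
have -> : widen_ord (leqnSn n) i = lift ord_max i by apply: val_inj; rewrite /= /bump leqNgt ltn_ord.
by rewrite /w liftK.
Qed.
End Eval.

Lemma msizeM_leq (K : fieldType) n (p q : {mpoly K[n]}) a b :
  (msize p <= a.+1)%N -> (msize q <= b.+1)%N -> (msize (p * q) <= (a + b).+1)%N.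
Proof.
move=> pa qb; have [->|p0] := eqVneq p 0; first by rewrite mul0r mmeasure0.
have [->|q0] := eqVneq q 0; first by rewrite mulr0 mmeasure0.
rewrite msizeM //; have := leq_add pa qb; rewrite addnS addSn.
by case: (_ + _)%N.
Qed.

Lemma card_bmnm_leq n b : (#|{: 'X_{1..n < b.+1}}| <= b.+1 ^ n)%N.
Proof.
pose f (m : 'X_{1..n < b.+1}) : {ffun 'I_n -> 'I_b.+1} := [ffun i => inord (m i)].
have <- : #|{ffun 'I_n -> 'I_b.+1}| = (b.+1 ^ n)%N by rewrite card_ffun !card_ord.
suff inj_f : injective f by rewrite -(card_codom inj_f) max_card.
move=> x y /ffunP exy; apply/val_inj/mnmP => i.
have lt (m : 'X_{1..n < b.+1}) : (m i < b.+1)%N.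
  by apply: leq_ltn_trans (bmdeg m); rewrite mdegE (bigD1 i) //= leq_addr.
by have := congr1 val (exy i); rewrite !ffunE /= !inordK.
Qed.

Section Dependence.
Variables (K : fieldType) (N M : nat) (F : 'I_N -> {mpoly K[M]}).

Definition alg_indep := forall Q, msubst F Q = 0 -> Q = 0.

(* Otherwise the monomials in the [F i] with exponents below [D] outnumber the
   monomials of the degrees they can reach. *)
Lemma alg_indep_leq : alg_indep -> (N <= M)%N.
Proof.
move=> indep; rewrite leqNgt; apply/negP => MN.
(* A product of the [F i] with exponents below [D] has degree at most [S < C * D], so these products
   lie in a space of dimension at most [(C * D)^M]. There are [D^N >= D * D^M] exponent vectors, and
   [D > C^M] makes this larger. *)
pose a := (\max_i msize (F i))%N.
pose C := (N * a).+1; pose D := (C ^ M).+1.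
pose S := (N * (D * a))%N.
pose E := {ffun 'I_N -> 'I_D}; pose B := {: 'X_{1..M < S.+1}}.
pose mon (e : E) : 'X_{1..N} := [multinom (e i : nat) | i < N].
have sz (e : E) : (msize (msubst F 'X_[mon e]) <= S.+1)%N.
  rewrite msubstX.
  have H (I : finType) (G : I -> {mpoly K[M]}) b (r : seq I) : (forall i, msize (G i) <= b.+1)%N ->
      (msize (\prod_(i <- r) G i) <= (size r * b).+1)%N.
    move=> hG; elim: r => [|i r IH]; first by rewrite big_nil msize1.
    by rewrite big_cons mulSn; apply: msizeM_leq.
  have := H _ (fun i => F i ^+ mon e i) (D * a)%N (index_enum 'I_N).
  rewrite -[index_enum _]enumT size_enum_ord; apply => i.
  have hk k : (msize (F i ^+ k) <= (k * a).+1)%N.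
    elim: k => [|k IH]; first by rewrite expr0 msize1.
    rewrite exprS mulSn; apply: msizeM_leq => //.
    by apply/leqW/(leq_bigmax (F := fun i => msize (F i))).
  apply: leq_trans (hk _) _; rewrite ltnS leq_mul2r mnmE ltnW ?orbT //.
pose A : 'M[K]_(#|E|, #|B|) :=
  \matrix_(e, b) (msubst F 'X_[mon (enum_val e)])@_(val (enum_val b)).
have ltBE : (#|B| < #|E|)%N.
  apply: leq_ltn_trans (card_bmnm_leq _ _) _.
  rewrite card_ffun !card_ord.
  have SD : (S.+1 <= C * D)%N.
    by rewrite /C mulSn /S mulnA mulnAC addnC -addn1 leq_add2l.
  apply: (@leq_ltn_trans ((C * D) ^ M)%N); first by elim: (M) => // k IH; rewrite !expnS leq_mul.
  rewrite expnMn; apply: (@leq_trans (D ^ M.+1)); last by rewrite leq_pexp2l.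
  by rewrite expnS ltn_mul2r expn_gt0 /= /D ltnSn.
have : kermx A != 0.
  rewrite kermx_eq0; apply/negP => /eqP rk.
  by have := rank_leq_col A; rewrite rk leqNgt ltBE.
case/rowV0Pn => u /sub_kermxP uA u0.
pose Q := \sum_e u 0 (enum_rank e) *: 'X_[mon e] : {mpoly K[N]}.
have Q0 : Q = 0.
  apply: indep; apply/mpolyP => m; rewrite mcoeff0.
  have [mS|Sm] := ltnP (mdeg m) S.+1; last first.
    rewrite memN_msupp_eq0 //; apply: msize_mdeg_ge; apply: leq_trans Sm.
    rewrite raddf_sum; apply: leq_trans (msize_sum _ _ _) _.
    apply/bigmax_leqP_seq => e _ _; rewrite /= linearZ /=.
    by apply: leq_trans (msizeZ_le _ _) (sz _).
  pose b := BMultinom mS.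
  have := congr1 (fun v : 'rV[K]__ => v 0 (enum_rank b)) uA; rewrite !mxE => <-.
  rewrite /Q (raddf_sum (msubst F)) /= raddf_sum /= (reindex (enum_val : 'I_#|E| -> E)) /=; last first.
    by exists enum_rank => ? _; rewrite ?enum_valK ?enum_rankK.
  by apply: eq_bigr => e _; rewrite !mxE linearZ /= mcoeffZ enum_valK enum_rankK.
case/negP: u0; apply/eqP/rowP => j; rewrite mxE.
have := congr1 (mcoeff (mon (enum_val j))) Q0; rewrite mcoeff0 raddf_sum /=.
rewrite (bigD1 (enum_val j)) //= mcoeffZ mcoeffX eqxx mulr1 enum_valK big1 ?addr0 // => e ej.
rewrite mcoeffZ mcoeffX; case: eqP => [/mnmP em|]; last by rewrite mulr0.
case/eqP: ej; apply/ffunP => i; apply: val_inj.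
by have := em i; rewrite !mnmE.
Qed.
End Dependence.

Section Jacobian.
Variables (K : fieldType) (charK0 : [pchar K] =i pred0).

Definition jacobian N M (F : 'I_N -> {mpoly K[M]}) : 'M[{mpoly K[M]}]_(N, M) :=
  \matrix_(i, j) (F i)^`M(j).

Notation tf := (map_mx (@tofrac _)).

Lemma msize_mderiv n (i : 'I_n) (Q : {mpoly K[n]}) k : (msize Q <= k.+1)%N -> (msize Q^`M(i) <= k)%N.
Proof.
move=> Qk; rewrite msizeE; apply/bigmax_leqP_seq => m mQ _.
have : Q@_(m + U_(i)) != 0.
  by move: mQ; rewrite mcoeff_msupp mcoeff_mderiv; apply: contra => /eqP->; rewrite mul0rn.
rewrite -mcoeff_msupp => /msize_mdeg_lt; rewrite mdegD mdeg1 addn1 => h.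
by rewrite -ltnS; apply: leq_trans Qk.
Qed.

Lemma mderiv_eq0_coef n (i : 'I_n) (Q : {mpoly K[n]}) (m : 'X_{1..n}) : Q^`M(i) = 0 -> m i != 0%N -> Q@_m = 0.
Proof.
move=> Q0 mi; have := congr1 (mcoeff (m - U_(i))%MM) Q0; rewrite mcoeff0 mcoeff_mderiv.
rewrite submK ?lep1mP // => /eqP; rewrite -mulr_natr mulf_eq0 natf_eq0 // orbF.
by move/eqP.
Qed.

(* A relation of least degree has all its partial derivatives zero. *)
Lemma jacobian_indep N M (F : 'I_N -> {mpoly K[M]}) :
  row_free (tf (jacobian F)) -> alg_indep F.
Proof.
move=> rf Q; have [k] := ubnP (msize Q); elim: k Q => [|k IH] Q // Qk Q0.
have dQ i : Q^`M(i) = 0.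
  case: k Qk IH => [|k] Qk IH.
    have -> : Q = 0 by apply/eqP; rewrite -msize_poly_eq0 -leqn0.
    by rewrite mderiv0.
  apply: IH; first by rewrite ltnS; apply: msize_mderiv.
  pose u : 'rV_N := \row_i msubst F Q^`M(i).
  have uJ : u *m jacobian F = 0.
    have e j := congr1 (mderiv j) Q0; apply/rowP => j; rewrite !mxE.
    rewrite -[RHS](mderiv0 _ j) -[RHS]e mderiv_msubst.
    by apply: eq_bigr => l _; rewrite !mxE.
  have : tf u = 0.
    apply: (row_free_inj rf); rewrite -map_mxM uJ; apply/matrixP => ? ?.
    by rewrite mul0mx !mxE rmorph0.
  by move/rowP/(_ i); rewrite !mxE => /eqP; rewrite tofrac_eq0 => /eqP.
have Qc : Q = (Q@_0)%:MP.
  apply/mpolyP => m; rewrite mcoeffC; case: eqP => [->|/eqP m0]; first by rewrite mulr1.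
  have [i mi] : exists i, m i != 0%N.
    apply/existsP; rewrite -negb_forall; apply: contra m0 => /forallP m0.
    by apply/eqP/mnmP => i; rewrite mnm0E; apply/eqP.
  by rewrite mulr0 (mderiv_eq0_coef (dQ i)).
by move: Q0; rewrite Qc msubstC => /eqP; rewrite mpolyC_eq0 => /eqP->; rewrite mpolyC0.
Qed.

(** * Adjoining a variable to an algebraically independent family *)

Section Extend.
Variables (N M : nat) (F : 'I_N -> {mpoly K[M]}) (j : 'I_M).

Definition extX (i : 'I_(N + 1)) : {mpoly K[M]} :=
  if split i is inl k then F k else 'X_j.

Let W (i : 'I_N) : {mpoly K[N + 1]} := 'X_(lshift 1 i).
Let G (i : 'I_(N + 1)) : {mpoly K[N]} := if split i is inl k then 'X_k else 0.
Let z : 'I_(N + 1) := rshift N ord0.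

(** In characteristic zero a vanishing derivative means that the last variable does not occur, so
    setting it to zero loses nothing. *)
Lemma msubstWG Q : Q^`M(z) = 0 -> msubst W (msubst G Q) = Q.
Proof.
move=> Q0; rewrite msubst_comp [in RHS](mpolyE Q) [in LHS](mpolyE Q) raddf_sum /=.
rewrite big_seq [RHS]big_seq; apply: eq_bigr => m mQ; rewrite linearZ /=; congr (_ *: _).
have mz : m z = 0%N.
  by apply/eqP; apply: contraLR mQ => h; rewrite mcoeff_msupp (mderiv_eq0_coef Q0 h) eqxx.
rewrite msubstX [in RHS]mpolyXE_id big_split_ord [RHS]big_split_ord /= !big_ord1 /=.
rewrite -/z mz !expr0 !mulr1; apply: eq_bigr => i _.
by rewrite /G -[lshift 1 i]/(unsplit (inl i)) unsplitK msubstU.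
Qed.

(** Start from a nonzero relation [Q] and differentiate in the last variable as long as the result
    is again a relation; the size drops each time. The derivative is never the zero polynomial,
    since [Q] would then be a relation of [F] alone. *)
Lemma dep_ext : alg_indep F -> ~ alg_indep extX ->
  exists2 Q, msubst extX Q = 0 & msubst extX Q^`M(z) != 0.
Proof.
move=> indep dep.
suff H k Q : (msize Q <= k)%N -> Q != 0 -> msubst extX Q = 0 ->
    exists2 Q, msubst extX Q = 0 & msubst extX Q^`M(z) != 0.
  apply: Classical_Prop.NNPP => no; apply: dep => Q Q0; apply/eqP; apply/negPn/negP => nQ.
  by apply: no; apply: (H (msize Q) Q).
elim: k Q => [|k IH] Q Qk nQ Q0; first by rewrite leqn0 msize_poly_eq0 (negbTE nQ) in Qk.
have [e|] := eqVneq (msubst extX Q^`M(z)) 0; last by exists Q.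
have [dQ|dQ] := eqVneq (Q^`M(z)) 0; last exact: IH (msize_mderiv _ Qk) dQ e.
have := msubstWG dQ; set Q' := msubst G Q => QE; case/eqP: nQ.
rewrite -QE (_ : Q' = 0) ?raddf0 //.
apply: indep; move: Q0; rewrite -{1}QE msubst_comp => <-; apply: eq_msubst => i.
by rewrite msubstU /extX -[lshift 1 i]/(unsplit (inl i)) unsplitK.
Qed.

(** Differentiating the relation of [dep_ext] gives a combination of the [dF_i] plus [R dx_j] equal
    to zero with [R] nonzero; divide by [R] in the fraction field. *)
Lemma delta_sub_jacobian : alg_indep F -> ~ alg_indep extX ->
  ((delta_mx 0 j : 'rV_M) <= tf (jacobian F))%MS.
Proof.
move=> indep dep; have [Q Q0 R0] := dep_ext indep dep.
set R := msubst extX _ in R0.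
pose u : 'rV_N := \row_i msubst extX Q^`M(lshift 1 i).
have uJ : u *m jacobian F + R *: (delta_mx 0 j : 'rV_M) = 0.
  have e k := congr1 (mderiv k) Q0; apply/rowP => k; rewrite !mxE.
  rewrite -[RHS](mderiv0 _ k) -[RHS]e mderiv_msubst big_split_ord /= big_ord1.
  congr (_ + _).
    by apply: eq_bigr => l _; rewrite !mxE /extX -[lshift 1 l]/(unsplit (inl l)) unsplitK.
  rewrite -/z -/R /extX -[z]/(unsplit (inr ord0)) unsplitK mderivX mnm1E; congr (_ * _).
  have [->|jk] := eqVneq j k; last by rewrite scale0r ?andbF.
  by rewrite scale1r ?eqxx -[X in 'X_[X - _]]add0m addmK mpolyX0.
have R0' : tofrac R != 0 by rewrite tofrac_eq0.
have : tf (u *m jacobian F + R *: (delta_mx 0 j : 'rV_M)) = 0.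
  by rewrite uJ; apply/matrixP => ? ?; rewrite !mxE rmorph0.
rewrite map_mxD map_mxZ map_mxM map_delta_mx => /eqP; rewrite addr_eq0 => /eqP e.
have -> : (delta_mx 0 j : 'rV_M) = (- (tofrac R)^-1) *: (tf u *m tf (jacobian F)).
  by rewrite e scalerN scaleNr opprK scalerA mulVf // scale1r.
by apply/scalemx_sub/submxMl.
Qed.

End Extend.

(* Adjoin variables as long as [F] stays independent; once none can be added, the
   differential of every variable is a combination of those of the family. *)
Lemma indep_jacobian N M (F : 'I_N -> {mpoly K[M]}) :
  alg_indep F -> row_free (tf (jacobian F)).
Proof.
have [k] := ubnP (M - N)%N; elim: k N F => // k IH N F; rewrite ltnS => kN indep.
have NM := alg_indep_leq indep.
have [[j jind]|no] := Classical_Prop.classic (exists j, alg_indep (extX F j)).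
  have NM' := alg_indep_leq jind.
  have /IH/(_ jind) : (M - (N + 1) < k)%N.
    by apply: leq_trans kN; rewrite ltn_sub2l ?addn1 // -addn1.
  set J := tf _ => rf.
  have -> : tf (jacobian F) = usubmx J.
    apply/matrixP => a b; rewrite !mxE /extX -[lshift 1 a]/(unsplit (inl a)) unsplitK //.
  rewrite /row_free eqn_leq rank_leq_row /=.
  move: rf; rewrite -{1}(vsubmxK J) /row_free => /eqP rf.
  (* Removing the row of the adjoined variable lowers the rank by at most one. *)
  have := mxrank_adds_leqif (usubmx J) (dsubmx J); rewrite addsmxE rf => -[h _].
  have := leq_trans h (leq_add (leqnn _) (rank_leq_row (dsubmx J))).
  by rewrite leq_add2r.
have full : row_full (tf (jacobian F)).
  rewrite -sub1mx; apply/row_subP => j; rewrite row1.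
  by apply: delta_sub_jacobian => // ind; apply: no; exists j.
rewrite /row_free eqn_leq rank_leq_row /=; move: full; rewrite /row_full => /eqP->.
exact: NM.
Qed.

(** A right inverse at [v], viewed as a constant matrix, gives a product whose determinant has value
    1 at [v], so it is a nonzero polynomial. *)
Lemma row_free_eval N M (J : 'M[{mpoly K[M]}]_(N, M)) v :
  row_free (map_mx (meval v) J) -> row_free (tf J).
Proof.
case/row_freeP => B JB; apply/row_freeP.
pose D := J *m map_mx (@mpolyC M K) B.
have dD : \det D != 0.
  have : (\det D).@[v] = 1.
    rewrite -det_map_mx map_mxM -map_mx_comp /= (_ : map_mx _ B = B) ?JB ?det1 //.
    by apply/matrixP => a b; rewrite !mxE /= mevalC.
  by apply: contra_eqN => /eqP->; rewrite meval0 eq_sym oner_neq0.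
have uD : tf D \in unitmx by rewrite unitmxE det_map_mx unitfE tofrac_eq0.
exists (tf (map_mx (@mpolyC M K) B) *m invmx (tf D)).
by rewrite mulmxA -map_mxM -/D mulmxV.
Qed.

(** Some maximal minor is a nonzero polynomial; any point where it does not vanish will do. *)
Lemma row_free_eval_ex N M (J : 'M[{mpoly K[M]}]_(N, M)) :
  row_free (tf J) -> exists v, row_free (map_mx (meval v) J).
Proof.
move=> rf; have rfl : row_full (tf J)^T by rewrite /row_full mxrank_tr.
have := fullrowsub_unit rfl; set f := fullrankfun _.
have -> : rowsub f (tf J)^T = tf (rowsub f J^T) by apply/matrixP => a b; rewrite !mxE.
rewrite unitmxE det_map_mx unitfE tofrac_eq0 => /(mpoly_nonroot charK0)[v].
rewrite -det_map_mx -unitfE -unitmxE => uv; exists v.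
rewrite -row_leq_rank -mxrank_tr -[X in (X <= _)%N](mxrank_unit uv).
have -> : map_mx (meval v) (rowsub f J^T) = rowsub f (map_mx (meval v) J)^T.
  by apply/matrixP => a b; rewrite !mxE.
by rewrite mxrankS // rowsub_sub.
Qed.

End Jacobian.

(** * Dominant maps and quantifier elimination *)

Section Generic.
Variables (K : fieldType) (N : nat).

Definition coord_seq (y : 'I_N -> K) : seq K := [seq y i | i <- enum 'I_N].

Lemma nth_coord_seq y (i : 'I_N) : (coord_seq y)`_i = y i.
Proof. by rewrite (nth_map i) ?size_enum_ord // nth_ord_enum. Qed.

(** Variables of index at least [N] become 0, the default value read beyond the end of [coord_seq];
    inverses do not occur in the ring terms to which this is applied. *)
Fixpoint mpoly_of_term (t : GRing.term K) : {mpoly K[N]} :=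
  match t with
  | GRing.Var i => if insub i is Some j then 'X_j else 0
  | GRing.Const c => c%:MP
  | GRing.NatConst n => n%:R
  | GRing.Add t u => mpoly_of_term t + mpoly_of_term u
  | GRing.Opp t => - mpoly_of_term t
  | GRing.NatMul t n => mpoly_of_term t *+ n
  | GRing.Mul t u => mpoly_of_term t * mpoly_of_term u
  | GRing.Inv t => 0
  | GRing.Exp t n => mpoly_of_term t ^+ n
  end.

Lemma eval_mpoly_of_term y t : GRing.rterm t ->
  GRing.eval (coord_seq y) t = (mpoly_of_term t).@[y].
Proof.
elim: t => /=.
- move=> i _; case: insubP => [j _ <-|]; first by rewrite mevalXU nth_coord_seq.
  by rewrite -leqNgt => Ni; rewrite meval0 nth_default // size_map size_enum_ord.
- by move=> c _; rewrite mevalC.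
- by move=> n _; rewrite rmorph_nat.
- by move=> t IHt u IHu /andP[/IHt-> /IHu->]; rewrite mevalD.
- by move=> t IHt /IHt->; rewrite mevalN.
- by move=> t IHt n /IHt->; rewrite mevalMn.
- by move=> t IHt u IHu /andP[/IHt-> /IHu->]; rewrite mevalM.
- by [].
- by move=> t IHt n /IHt->; rewrite rmorphXn.
Qed.

(** A constructible condition is constant on a nonempty open set: an equation is an identity or
    fails off a hypersurface, and connectives multiply the exceptional polynomials. *)
Lemma qf_generic (f : GRing.formula K) : GRing.qf_form f -> GRing.rformula f ->
  exists2 P : {mpoly K[N]}, P != 0 &
    exists b, forall y, P.@[y] != 0 -> GRing.qf_eval (coord_seq y) f = b.
Proof.
have bin (op : bool -> bool -> bool) (f1 f2 f12 : GRing.formula K) :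
    (forall e, GRing.qf_eval e f12 = op (GRing.qf_eval e f1) (GRing.qf_eval e f2)) ->
    (exists2 P : {mpoly K[N]}, P != 0 &
      exists b, forall y, P.@[y] != 0 -> GRing.qf_eval (coord_seq y) f1 = b) ->
    (exists2 P : {mpoly K[N]}, P != 0 &
      exists b, forall y, P.@[y] != 0 -> GRing.qf_eval (coord_seq y) f2 = b) ->
    exists2 P : {mpoly K[N]}, P != 0 &
      exists b, forall y, P.@[y] != 0 -> GRing.qf_eval (coord_seq y) f12 = b.
  move=> opE [P1 P10 [b1 h1]] [P2 P20 [b2 h2]]; exists (P1 * P2); first by rewrite mulf_neq0.
  exists (op b1 b2) => y; rewrite mevalM mulf_eq0 => /norP[/h1 e1 /h2 e2].
  by rewrite opE e1 e2.
elim: f => //=.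
- by move=> b _ _; exists 1; [exact: oner_neq0|exists b].
- move=> t u _ /andP[rt ru].
  have [e|ne] := eqVneq (mpoly_of_term t) (mpoly_of_term u).
    by exists 1; [exact: oner_neq0|exists true => y _; rewrite !eval_mpoly_of_term // e eqxx].
  exists (mpoly_of_term t - mpoly_of_term u); first by rewrite subr_eq0.
  by exists false => y; rewrite mevalB subr_eq0 !eval_mpoly_of_term // => /negbTE.
- move=> f1 IH1 f2 IH2 /andP[q1 q2] /andP[r1 r2].
  exact: (bin andb f1 f2 (GRing.And f1 f2) _ (IH1 q1 r1) (IH2 q2 r2)).
- move=> f1 IH1 f2 IH2 /andP[q1 q2] /andP[r1 r2].
  exact: (bin orb f1 f2 (GRing.Or f1 f2) _ (IH1 q1 r1) (IH2 q2 r2)).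
- move=> f1 IH1 f2 IH2 /andP[q1 q2] /andP[r1 r2].
  exact: (bin implb f1 f2 (GRing.Implies f1 f2) _ (IH1 q1 r1) (IH2 q2 r2)).
- by move=> f IH q r; exact: (bin (fun b _ => ~~ b) f f (GRing.Not f) _ (IH q r) (IH q r)).
Qed.

Variable M : nat.

(** In the environment the first [N] entries hold the target point and the next [M] the source
    point, whence the shift by [N]. *)
Definition mon_term (m : 'X_{1..M}) (s : seq 'I_M) : GRing.term K :=
  foldr (fun (i : 'I_M) u => GRing.Mul (GRing.Exp (GRing.Var K (N + i)) (m i)) u) (GRing.Const 1) s.

Definition term_of_mpoly (p : {mpoly K[M]}) (s : seq 'X_{1..M}) : GRing.term K :=
  foldr (fun m t => GRing.Add (GRing.Mul (GRing.Const p@_m) (mon_term m (enum 'I_M))) t)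
    (GRing.Const 0) s.

Lemma rterm_of_mpoly p s : GRing.rterm (term_of_mpoly p s).
Proof.
elim: s => //= m s ->; rewrite andbT.
by elim: (enum 'I_M).
Qed.

Lemma eval_term_of_mpoly p (e : seq K) :
  GRing.eval e (term_of_mpoly p (msupp p)) = p.@[fun i => e`_(N + i)].
Proof.
rewrite mevalE; elim: (msupp p) => [|m s IH] /=; first by rewrite big_nil.
rewrite big_cons IH; congr (_ * _ + _); rewrite -big_enum /=.
by elim: (enum 'I_M) => [|i r IHr] /=; rewrite ?big_nil // big_cons IHr.
Qed.

Definition graph_formula (F : 'I_N -> {mpoly K[M]}) : GRing.formula K :=
  foldr (fun (i : 'I_N) f => GRing.And (GRing.Equal (GRing.Var K i) (term_of_mpoly (F i) (msupp (F i)))) f)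
    (GRing.Bool true) (enum 'I_N).

Lemma graph_formulaP F e :
  GRing.holds e (graph_formula F) <->
  forall i : 'I_N, e`_i = (F i).@[fun i => e`_(N + i)].
Proof.
have -> : (forall i : 'I_N, e`_i = (F i).@[fun i => e`_(N + i)]) <->
   {in enum 'I_N, forall i : 'I_N, e`_i = (F i).@[fun i => e`_(N + i)]}.
  by split=> h i; [move=> _; apply: h|apply: h; rewrite mem_enum].
rewrite /graph_formula; elim: (enum 'I_N) => [|i s IH] /=; first by split.
rewrite eval_term_of_mpoly; split=> [[h1 /IH h2] j|h].
  by rewrite inE => /orP[/eqP->|/h2].
split; first by apply: h; rewrite mem_head.
by apply/IH => j js; apply: h; rewrite inE js orbT.
Qed.
End Generic.

(* The image is constructible, so it contains a nonempty open set or lies in a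
   hypersurface. *)
Lemma alg_indep_dominant (K : closedFieldType) (charK0 : [pchar K] =i pred0) N M
    (F : 'I_N -> {mpoly K[M]}) : alg_indep F ->
  exists2 P : {mpoly K[N]}, P != 0 &
    forall y, P.@[y] != 0 -> exists x, forall i, (F i).@[x] = y i.
Proof.
move=> indep.
pose f := foldr (@GRing.Exists K) (graph_formula F) (iota N M).
have rf : GRing.rformula f.
  have rg : GRing.rformula (graph_formula F).
    by rewrite /graph_formula; elim: (enum _) => //= i s ->; rewrite rterm_of_mpoly.
  by rewrite /f; elim: (iota N M).
have Kcl : GRing.closed_field_axiom K by exact: GRing.solve_monicpoly.
have qeP e := GRing.quantifier_elim_rformP (@ClosedFieldQE.wf_ex_elim K)
  (ClosedFieldQE.holds_ex_elim Kcl) e rf.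
have /andP[qf qrf] := GRing.quantifier_elim_wf (@ClosedFieldQE.wf_ex_elim K) rf.
have [P P0 [b Pb]] := qf_generic N qf qrf.
have fP y : GRing.holds (coord_seq y) f <-> exists x, forall i, (F i).@[x] = y i.
  rewrite -GRing.foldExistsP; split=> [[e' ee' /graph_formulaP h]|[x xy]].
    exists (fun i => e'`_(N + i)) => i; rewrite -h -ee' ?nth_coord_seq // inE mem_iota.
    by rewrite /= negb_and -ltnNge ltn_ord.
  have szy : size (coord_seq y) = N by rewrite size_map size_enum_ord.
  exists (coord_seq y ++ coord_seq x).
    move=> i; rewrite inE mem_iota /= negb_and -ltnNge nth_cat szy => /orP[->//|].
    rewrite -leqNgt => NMi; rewrite !nth_default ?if_same //.
      by rewrite size_map size_enum_ord -(leq_add2l N) subnKC // (leq_trans (leq_addr _ _) NMi).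
    by rewrite szy (leq_trans (leq_addr _ _) NMi).
  apply/graph_formulaP => i; rewrite nth_cat szy ltn_ord nth_coord_seq -xy; apply: meval_eq => j.
  by rewrite nth_cat szy ltnNge leq_addr /= addKn nth_coord_seq.
exists P => // y Py; apply/fP/qeP; rewrite (Pb _ Py).
(* If the generic truth value were false, [P] would vanish on the whole image and so be a relation
   among the [F i]. *)
case: b Pb => // Pb; case/negP: P0; apply/eqP/indep.
apply/eqP; apply/negPn/negP => /(mpoly_nonroot charK0)[x].
rewrite meval_msubst => /Pb /negP[]; apply/qeP/fP.
by exists x.
Qed.

(** * Quadratic maps and their differentials *)

Section QuadraticMap.
Variables (K : closedFieldType) (charK0 : [pchar K] =i pred0).
Variables (V : vectType K) (T : finType) (b : T -> T -> V).

Definition quad (c : T -> K) : V := \sum_s \sum_t (c s * c t) *: b s t.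
(** The partial derivative of [quad] at [c] with respect to the coordinate [s]. *)
Definition dquad (c : T -> K) (s : T) : V := \sum_t c t *: (b s t + b t s).

Let N : nat := \dim {:V}.
Let vc (i : 'I_N) (v : V) : K := vcoords v i.
Let F (i : 'I_N) : {mpoly K[#|T|]} :=
  \sum_s \sum_t vc i (b s t) *: ('X_(enum_rank s) * 'X_(enum_rank t)).

Let vcZ i a v : vc i (a *: v) = a * vc i v.
Proof. by rewrite /vc /vcoords linearZ. Qed.

Let vcD i v w : vc i (v + w) = vc i v + vc i w.
Proof. by rewrite /vc /vcoords raddfD. Qed.

Let vc_sum i (I : finType) (G : I -> V) : vc i (\sum_j G j) = \sum_j vc i (G j).
Proof. by rewrite /vc /vcoords raddf_sum. Qed.

Let F_eval i x : (F i).@[x] = vc i (quad (fun s => x (enum_rank s))).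
Proof.
rewrite /F raddf_sum vc_sum; apply: eq_bigr => s _.
rewrite raddf_sum vc_sum; apply: eq_bigr => t _.
by rewrite /= mevalZ mevalM !mevalXU vcZ mulrC.
Qed.

Let dF_eval i j x :
  ((F i)^`M(j)).@[x] = vc i (dquad (fun s => x (enum_rank s)) (enum_val j)).
Proof.
have dX (s : T) : ('X_(enum_rank s))^`M(j) = (enum_val j == s)%:R%:MP :> {mpoly K[#|T|]}.
  rewrite mderivX mnm1E -(inj_eq enum_val_inj) enum_rankK eq_sym.
  case: eqP => [<-|_]; last by rewrite scale0r mpolyC0.
  by rewrite scale1r enum_valK -[X in 'X_[X - _]]add0m addmK mpolyX0 mpolyC1.
rewrite /F (raddf_sum (mderiv j)) /= (raddf_sum (meval x)) /= /dquad vc_sum /=.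
have E (G : T -> T -> K) : \sum_s \sum_t G s t *
    ((enum_val j == s)%:R * x (enum_rank t) + x (enum_rank s) * (enum_val j == t)%:R)
    = \sum_t x (enum_rank t) * (G (enum_val j) t + G t (enum_val j)).
  transitivity (\sum_s \sum_t (G s t * x (enum_rank t) * (enum_val j == s)%:R +
       G s t * x (enum_rank s) * (enum_val j == t)%:R)).
    by apply: eq_bigr => s _; apply: eq_bigr => t _; rewrite mulrDr !mulrA; congr (_ + _); rewrite mulrAC.
  under eq_bigr => s _ do rewrite big_split /=.
  rewrite big_split /= (bigD1 (enum_val j)) //= [X in _ + X + _]big1 ?addr0; last first.
    by move=> s sj; rewrite big1 // => t _; rewrite eq_sym (negbTE sj) mulr0.
  rewrite -big_split; apply: eq_bigr => t _ /=; rewrite eqxx mulr1 mulrDr mulrC; congr (_ + _).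
  rewrite (bigD1 (enum_val j)) //= eqxx mulr1 big1 ?addr0 1?mulrC // => s sj.
  by rewrite eq_sym (negbTE sj) mulr0.
transitivity (\sum_s \sum_t vc i (b s t) *
    ((enum_val j == s)%:R * x (enum_rank t) + x (enum_rank s) * (enum_val j == t)%:R)).
  apply: eq_bigr => s _; rewrite (raddf_sum (mderiv j)) /= (raddf_sum (meval x)) /=; apply: eq_bigr => t _.
  by rewrite /= mderivZ mevalZ mderivM !dX mevalD !mevalM !mevalXU !mevalC.
by rewrite E; apply: eq_bigr => t _; rewrite vcZ vcD.
Qed.

Let vbasis_full : basis_of {:V} (vbasis {:V}). Proof. exact: vbasisP. Qed.

Let vc_inj v w : (forall i, vc i v = vc i w) -> v = w.
Proof.
move=> vw; rewrite (coord_basis vbasis_full (memvf v)) (coord_basis vbasis_full (memvf w)).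
by apply: eq_bigr => i _; congr (_ *: _); apply: vw.
Qed.

(** The columns of the Jacobian at [x] are the coordinates of the partial derivatives, and a row
    vector in its left kernel is a linear functional vanishing on their span. *)
Let jac_span x :
  row_free (map_mx (meval x) (jacobian F)) =
  (<<[seq dquad (fun s => x (enum_rank s)) s | s <- enum T]>>%VS == {:V}%VS).
Proof.
pose c (s : T) := x (enum_rank s); rewrite -/c; apply/idP/eqP.
  case/row_freeP => B JB; apply/eqP; rewrite eqEsubv subvf /=.
  have /andP[/eqP <- _] := vbasis_full; apply/span_subvP => v /(nthP 0)[k].
  rewrite size_tuple => kN <-; pose k' := Ordinal kN.
  suff -> : (vbasis {:V})`_k = \sum_j B j k' *: dquad c (enum_val j).
    by apply: memv_suml => j _; apply/memvZ/memv_span/map_f; rewrite mem_enum.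
  apply: vc_inj => i; rewrite vc_sum.
  have := congr1 (fun A : 'M[K]_N => A i k') JB; rewrite !mxE => e.
  rewrite /vc /vcoords -[(vbasis _)`_k]/((vbasis {:V})`_k') coord_free; last exact: basis_free vbasis_full.
  rewrite eq_sym -e; apply: eq_bigr => j _; rewrite !mxE dF_eval -/c mulrC.
  by rewrite -vcZ.
move=> full; rewrite -kermx_eq0; apply/negPn/negP => /rowV0Pn[u /sub_kermxP uJ].
case/negP; apply/eqP/rowP => k; rewrite mxE.
have H v : v \in <<[seq dquad c s | s <- enum T]>>%VS -> \sum_i u 0 i * vc i v = 0.
  pose f : 'Hom(V, K^o) := \sum_i u 0 i *: linfun (coord (vbasis {:V}) i : V -> K^o).
  have fE w : f w = \sum_i u 0 i * vc i w.
    by rewrite sum_lfunE; apply: eq_bigr => i _; rewrite scale_lfunE lfunE.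
  rewrite -fE => vX; suff : v \in lker f by rewrite memv_ker => /eqP.
  apply: subvP vX; apply/span_subvP => w /mapP[s _ ->]; rewrite memv_ker fE.
  have := congr1 (fun A : 'rV[K]__ => A 0 (enum_rank s)) uJ; rewrite !mxE => e.
  by apply/eqP; rewrite -[RHS]e; apply: eq_bigr => i _; rewrite !mxE dF_eval enum_rankK.
have := H (vbasis {:V})`_k; rewrite full => /(_ (memvf _)); rewrite (bigD1 k) //=.
have fr : free (vbasis {:V}) by exact: basis_free vbasis_full.
rewrite /vc /vcoords coord_free // eqxx mulr1 big1 ?addr0 // => i ik.
by rewrite coord_free // eq_sym (negbTE ik) mulr0.
Qed.

Lemma quad_dominant c : <<[seq dquad c s | s <- enum T]>>%VS = {:V}%VS ->
  exists2 P : {mpoly K[N]}, P != 0 & forall v, P.@[vcoords v] != 0 -> exists c, quad c = v.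
Proof.
move=> full; pose x (j : 'I_#|T|) := c (enum_val j).
have rf : row_free (map_mx (meval x) (jacobian F)).
  rewrite jac_span -full; apply/eqP; congr span; apply: eq_map => s.
  by apply: eq_bigr => t _; rewrite /x enum_rankK.
have [P P0 hP] := alg_indep_dominant charK0 (jacobian_indep charK0 (row_free_eval rf)).
exists P => // v /hP[y hy]; exists (fun s => y (enum_rank s)).
by apply: vc_inj => i; rewrite -F_eval hy.
Qed.

Lemma quad_not_dominant : (forall c, <<[seq dquad c s | s <- enum T]>>%VS <> {:V}%VS) ->
  exists2 P : {mpoly K[N]}, P != 0 & forall c, P.@[vcoords (quad c)] = 0.
Proof.
move=> nfull.
have dep : ~ alg_indep F.
  move=> /(indep_jacobian charK0)/(row_free_eval_ex charK0)[x].
  by rewrite jac_span => /eqP; apply: nfull.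
apply: Classical_Prop.NNPP => no; apply: dep => P P0; apply/eqP/negPn/negP => nP.
apply: no; exists P => // c.
have := congr1 (meval (fun j => c (enum_val j))) P0; rewrite meval_msubst meval0 => <-.
apply: meval_eq => i; rewrite F_eval; congr (vc i _).
by apply: eq_bigr => s _; apply: eq_bigr => t _; rewrite !enum_rankK.
Qed.

End QuadraticMap.

(** * Generic ideals *)

Section Cofinite.
Variables (K : fieldType) (charK0 : [pchar K] =i pred0).

Definition cofinitely (P : K -> Prop) :=
  exists2 q : {poly K}, q != 0 & forall t, ~~ root q t -> P t.

Lemma cofinitely_and P Q : cofinitely P -> cofinitely Q -> cofinitely (fun t => P t /\ Q t).
Proof.
move=> [p p0 hp] [q q0 hq]; exists (p * q); first by rewrite mulf_neq0.
by move=> t; rewrite rootM => /norP[/hp Pt /hq Qt].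
Qed.

Lemma cofinitely_all (I : finType) (P : I -> K -> Prop) :
  (forall i, cofinitely (P i)) -> cofinitely (fun t => forall i, P i t).
Proof.
move=> hP; suff [q q0 hq] : cofinitely (fun t => forall i, i \in enum I -> P i t).
  by exists q => // t /hq h i; apply: h; rewrite mem_enum.
elim: (enum I) => [|i s IH]; first by exists 1; rewrite ?oner_neq0.
have [q q0 hq] := cofinitely_and (hP i) IH; exists q => // t /hq[h1 h2] j.
by rewrite inE => /predU1P[->|/h2].
Qed.

Lemma cofinitely_ex P : cofinitely P -> exists t, P t.
Proof. by case=> q q0 hq; have [t /hq] := poly_nonroot charK0 q0; exists t. Qed.

Lemma cofinitely_imp (P Q : K -> Prop) : (forall t, P t -> Q t) -> cofinitely P -> cofinitely Q.
Proof. by move=> PQ [q q0 hq]; exists q => // t /hq /PQ. Qed.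

(** Lower semicontinuity of rank. Write a basis of the span at [t0] as combinations of the
    generators; the same combinations at [t] have a coordinate matrix polynomial in [t], of
    determinant 1 at [t0], and stay independent wherever that determinant is nonzero. *)
Lemma dim_span_line (V : vectType K) (s : seq (V * V)) t0 :
  cofinitely (fun t => leq (\dim <<[seq x.1 + t0 *: x.2 | x <- s]>>)
                           (\dim <<[seq x.1 + t *: x.2 | x <- s]>>)).
Proof.
pose X t := [seq x.1 + t *: x.2 | x <- s].
set U := <<_>>%VS; pose r : nat := \dim U; pose e := vbasis U.
have [c ec] : exists c : 'I_r -> nat -> K,
    forall j : 'I_r, e`_j = \sum_(i < size s) c j i *: (X t0)`_i.
  exists (fun j k => if insub k is Some i then coord (in_tuple (X t0)) i e`_j else 0) => j.
  have ejU : e`_j \in <<in_tuple (X t0)>>%VS by apply/vbasis_mem/mem_nth; rewrite size_tuple.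
  rewrite [LHS](coord_span ejU) -[in RHS](size_map (fun x => x.1 + t0 *: x.2)).
  by apply: eq_bigr => i _; rewrite valK.
pose E t j := \sum_(i < size s) c j i *: (X t)`_i.
have Xn t (i : 'I_(size s)) : (X t)`_i = (nth 0 s i).1 + t *: (nth 0 s i).2.
  by rewrite (nth_map 0).
(* Vectors at other values of [t] may leave [U], so they are projected before taking coordinates. *)
pose co (k : 'I_r) (v : V) := coord e k (projv U v).
pose A : 'M[{poly K}]_r := \matrix_(j, k)
   ((co k (\sum_(i < size s) c j i *: (nth 0 s i).1))%:P + co k (\sum_(i < size s) c j i *: (nth 0 s i).2) *: 'X).
have coD k v w : co k (v + w) = co k v + co k w by rewrite /co !linearD.
have coZ k a v : co k (a *: v) = a * co k v by rewrite /co !linearZ.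
have co0 k : co k 0 = 0 by rewrite /co !linear0.
have AE t : map_mx (horner_eval t) A = \matrix_(j, k) co k (E t j).
  apply/matrixP => j k; rewrite !mxE /horner_eval hornerD hornerC hornerZ hornerX.
  rewrite mulrC -coZ -coD scaler_sumr -big_split /=; congr (co k _); apply: eq_bigr => i _.
  by rewrite Xn scalerDr !scalerA mulrC.
exists (\det A).
  apply/eqP => dA; have := congr1 (horner_eval t0) dA.
  rewrite -det_map_mx AE /horner_eval horner0 (_ : \matrix_(_, _) _ = 1%:M).
    by rewrite det1 => /eqP; rewrite oner_eq0.
  apply/matrixP => j k; rewrite !mxE /E -ec /co projv_id; last first.
    by apply/vbasis_mem/mem_nth; rewrite size_tuple.
  by rewrite coord_free ?(basis_free (vbasisP U)) // eq_sym.
move=> t; rewrite /root -[_.[t]]/(horner_eval t _) -det_map_mx AE => dt.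
have fr : free [tuple E t j | j < r].
  apply/freeP => u hu.
  have : (\row_j u j) *m (\matrix_(j, k) co k (E t j)) = 0.
    apply/rowP => k; rewrite !mxE; under eq_bigr => j _ do rewrite !mxE -coZ.
    have cs (F : 'I_r -> V) : \sum_j co k (F j) = co k (\sum_j F j).
      by elim/big_rec2: _ => [|j y1 y2 _ ->]; rewrite ?co0 ?coD.
    rewrite cs -[RHS](co0 k); congr (co k _); rewrite -[RHS]hu; apply: eq_bigr => j _.
    by rewrite -tnth_nth tnth_mktuple.
  move=> um j; have uu : (\matrix_(j, k) co k (E t j)) \in unitmx by rewrite unitmxE unitfE.
  have /rowP/(_ j) : \row_j u j = 0 by rewrite -[LHS](mulmxK uu) um mul0mx.
  by rewrite !mxE.
rewrite -/r -[X in (X <= _)%N](size_tuple [tuple E t j | j < r]).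
move: fr; rewrite /free => /eqP <-; apply/dimvS/span_subvP => v /tnthP[j ->].
rewrite tnth_mktuple; apply: memv_suml => i _; apply/memvZ/memv_span/mem_nth.
by rewrite size_map.
Qed.
End Cofinite.

(** * Graded parts of ideals *)

Section Ideal.
Variables (K : fieldType) (n : nat).
Local Notation S k := (dhomog n.+1 K k).
Local Notation poly := {mpoly K[n.+1]}.

Definition hcomp k (p : poly) : S k := DHomog (pihomogP mdeg k p).

Lemma hcomp_is_linear k : linear (hcomp k).
Proof. by move=> a p q; apply: val_inj; rewrite /= linearP. Qed.

HB.instance Definition _ k := GRing.isLinear.Build K poly (S k) _ (hcomp k) (hcomp_is_linear k).

Lemma val_hcomp k p : p \is k.-homog -> val (hcomp k p) = p.
Proof. exact: pihomog_dE. Qed.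

Lemma hcompK k (u : S k) : hcomp k (val u) = u.
Proof. by apply: val_inj; rewrite (val_hcomp (dhomog_is_dhomog u)). Qed.

Lemma dhomogM_eq i j k (p q : poly) :
  p \is i.-homog -> q \is j.-homog -> (i + j)%N = k -> p * q \is k.-homog.
Proof. by move=> hp hq <-; apply: dhomogM. Qed.

(** Projecting to degree [k] makes this linear between fixed spaces for every [g]; for [g]
    homogeneous of degree [k - j] with [j <= k] it is plain multiplication. *)
Definition mulh g j k (u : S j) : S k := hcomp k (g * val u).

Lemma mulh_is_linear g j k : linear (@mulh g j k).
Proof. by move=> a u v; rewrite /mulh linearP /= mulrDr -scalerAr linearP. Qed.

HB.instance Definition _ g j k := GRing.isLinear.Build K (S j) (S k) _ (@mulh g j k) (@mulh_is_linear g j k).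

Definition mulhom g j k : 'Hom(S j, S k) := linfun (@mulh g j k).

Lemma mulhE g j k u : mulhom g j k u = hcomp k (g * val u).
Proof. by rewrite lfunE. Qed.

(* The degree [k] part of the ideal generated by forms [g] listed with a degree [e]. *)
Fixpoint ideal_part k (gs : seq (nat * poly)) : {vspace S k} :=
  if gs is ag :: gs' then
    ((if (ag.1 <= k)%N then limg (mulhom ag.2 (k - ag.1) k) else 0) + ideal_part k gs')%VS
  else 0%VS.

Definition homogs (gs : seq (nat * poly)) := all (fun ag => ag.2 \is (ag.1).-homog) gs.

Lemma dim_dhomog k : \dim {:S k} = 'C(k + n, k).
Proof. by rewrite dimvf. Qed.

Lemma mulhom_ideal_part e g k gs : g \is e.-homog -> homogs gs -> (e <= k)%N ->
  (mulhom g (k - e) k @: ideal_part (k - e) gs <= ideal_part k gs)%VS.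
Proof.
move=> ga + ak; elim: gs => [|[b p] gs IH] /=; first by rewrite limg0 subvv.
case/andP=> pb /IH {}IH; rewrite limgD; apply: addvS => //.
case: (leqP b (k - e)) => bka; last by rewrite limg0 sub0v.
have bk : (b <= k)%N by apply: leq_trans bka (leq_subr _ _).
rewrite bk -limg_comp; apply/subvP => _ /memv_imgP[w _ ->].
rewrite lfunE /= !mulhE val_hcomp; last first.
  by apply: (dhomogM_eq pb (dhomog_is_dhomog w)); lia.
have ka : (k - e - b)%N = (k - b - e)%N by rewrite subnAC.
have -> : hcomp k (g * (p * val w)) = mulhom p (k - b) k (hcomp (k - b) (g * val w)).
  rewrite mulhE val_hcomp; first by rewrite mulrCA.
  by apply: (dhomogM_eq ga (dhomog_is_dhomog w)); lia.
exact/memv_img/memvf.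
Qed.

(** The map [f] induces a surjection from [A / P] onto [(limg f + U) / U]. *)
Lemma dim_img_add (A B : vectType K) (f : 'Hom(A, B)) (P : {vspace A}) (U : {vspace B}) :
  (f @: P <= U)%VS -> (\dim (limg f + U) + \dim P <= \dim U + \dim {:A})%N.
Proof.
move=> fPU; have e1 := dimv_sum_cap (limg f) U.
have h1 : (\dim (f @: P) <= \dim (limg f :&: U))%N.
  by apply/dimvS; rewrite subv_cap fPU limgS ?subvf.
have e2 := limg_ker_dim f P; have e3 := limg_ker_dim f {:A}.
have h2 : (\dim (P :&: lker f) <= \dim ({:A} :&: lker f))%N by apply/dimvS/capvS; rewrite ?subvf.
rewrite -(leq_add2r (\dim (limg f :&: U))%N) addnAC e1.
rewrite -e3 -e2 addnCA -!addnA; lia.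
Qed.
End Ideal.

(** * Forms with the Hilbert function of a complete intersection *)

Section CI.
Variables (K : fieldType) (charK0 : [pchar K] =i pred0) (n : nat).
Local Notation S k := (dhomog n.+1 K k).
Local Notation poly := {mpoly K[n.+1]}.
Implicit Types gs : seq (nat * poly).

(* The Hilbert function is at most that of a complete intersection. Required of
   all tails, this open condition forces equality ([generic_hilb_dim]). *)
Definition generic_hilb d gs := forall j k, (j <= size gs)%N -> (k <= d)%N ->
  ('C(k + n, k) <= \dim (ideal_part k (drop j gs)) +
     ci_hilb (n.+1 - size (drop j gs)) (map fst (drop j gs)) k)%N.

(** Induction on the list. By [dim_img_add] a new generator of degree [e] enlarges the degree [k]
    part by at most the codimension of the old ideal in degree [k - e]; by [ci_hilb_cut] this is the
    inequality opposite to [generic_hilb]. *)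
Lemma generic_hilb_dim d gs : homogs gs -> (size gs <= n.+1)%N -> generic_hilb d gs ->
  forall k, (k <= d)%N ->
  (\dim (ideal_part k gs) + ci_hilb (n.+1 - size gs) (map fst gs) k)%N = 'C(k + n, k).
Proof.
elim: gs => [|[e g] gs IH] /=.
  by move=> _ _ _ k _; rewrite dimv0 subn0 ci_hilb_nil addnS subn1.
case/andP=> ge hgs sz rgs k kd.
have {}IH : forall k, (k <= d)%N ->
    (\dim (ideal_part k gs) + ci_hilb (n.+1 - size gs) (map fst gs) k)%N = 'C(k + n, k).
  by apply: IH => //; [exact: ltnW|move=> j k' jgs; apply: (rgs j.+1)].
have ME : (n.+1 - size gs = (n.+1 - (size gs).+1).+1)%N by lia.
have lb := rgs 0%N k (leq0n _) kd; rewrite /= in lb.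
apply/eqP; rewrite eqn_leq lb andbT.
have IHk := IH k kd; rewrite ME in IH IHk.
have tel := ci_hilb_cut (n.+1 - (size gs).+1) e (map fst gs) k.
rewrite delayE in tel; case: leqP tel => ek tel; last by rewrite add0v -IHk tel addn0.
have := dim_img_add (mulhom_ideal_part ge hgs ek); rewrite dim_dhomog.
rewrite -(IH (k - e)%N (leq_trans (leq_subr _ _) kd)) addnCA addnC leq_add2l => h.
by rewrite -IHk tel [(ci_hilb _ _ k + _)%N]addnC addnA leq_add2r.
Qed.

Definition line_pt (t : K) (x : nat * (poly * poly)) := (x.1, x.2.1 + t *: x.2.2).

(** The graded part is spanned by products of the generators with basis vectors, and these are
    affine in [t]. *)
Lemma ideal_part_line k (tr : seq (nat * (poly * poly))) :
  exists s : seq (S k * S k), forall t,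
    ideal_part k (map (line_pt t) tr) = <<[seq (x.1 + t *: x.2)%R | x <- s]>>%VS.
Proof.
elim: tr => [|[e [g g']] tr [s hs]] /=; first by exists [::] => t; rewrite span_nil.
have [ek|ek] := boolP (e <= k)%N; last by exists s => t; rewrite add0v hs.
exists ([seq (mulhom g (k - e) k b, mulhom g' (k - e) k b) | b <- vbasis {:S (k - e)}] ++ s) => t.
rewrite map_cat span_cat -hs; congr (_ + _)%VS.
have fullE : <<vbasis {:S (k - e)}>>%VS = {:S (k - e)}%VS.
  by have /andP[/eqP] := vbasisP {:S (k - e)}%VS.
rewrite -[X in (_ @: X)%VS]fullE limg_span -!map_comp; congr span; apply: eq_map => b /=.
by rewrite !mulhE mulrDl linearD -scalerAl linearZ.
Qed.

Lemma generic_hilb_line d tr t0 : generic_hilb d (map (line_pt t0) tr) ->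
  cofinitely (fun t => generic_hilb d (map (line_pt t) tr)).
Proof.
move=> rt0.
have : cofinitely (fun t => forall j : 'I_(size tr).+1, forall k : 'I_d.+1,
    ('C(k + n, k) <= \dim (ideal_part k (drop j (map (line_pt t) tr))) +
     ci_hilb (n.+1 - size (drop j (map (line_pt t) tr))) (map fst (drop j (map (line_pt t) tr))) k)%N).
  apply: cofinitely_all => j; apply: cofinitely_all => k.
  have [s hs] := ideal_part_line k (drop j tr).
  have := dim_span_line s t0; apply: cofinitely_imp => t; rewrite -!hs => h.
  have rt := rt0 j k; rewrite size_map -ltnS ltn_ord -ltnS ltn_ord in rt.
  apply: leq_trans (rt isT isT) _; rewrite -!map_drop !size_map -!map_comp.
  by rewrite leq_add2r.
apply: cofinitely_imp => t h j k jt kd; rewrite size_map in jt.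
exact: (h (Ordinal (jt : j < (size tr).+1)%N) (Ordinal (kd : k < d.+1)%N)).
Qed.

(** * Powers of distinct variables *)

Section Monomials.
Variable d : nat.
Implicit Type L : seq ('I_n.+1 * nat).

Definition power_gens L : seq (nat * poly) := [seq (x.2, 'X_(x.1) ^+ x.2) | x <- L].

(** The standard monomials of degree [k]: those divisible by none of the given powers. *)
Definition below k L (m : 'X_{1..n.+1}) := (mdeg m == k) && all (fun x => m x.1 < x.2)%N L.

Definition card_below k L := #|[set m : 'X_{1..n.+1 < d.+1} | below k L m]|.

Lemma mnm_in_ideal_part k L (m : 'X_{1..n.+1}) : mdeg m = k -> ~~ all (fun x => m x.1 < x.2)%N L ->
  hcomp k 'X_[m] \in ideal_part k (power_gens L).
Proof.
move=> mk; elim: L => [|[i e] L IH] //=; rewrite negb_and => /orP[|/IH h]; last first.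
  exact: subvP (addvSr _ _) _ h.
rewrite -leqNgt => em; apply: subvP (addvSl _ _) _ _.
have mE : m = (U_(i) *+ e + (m - U_(i) *+ e))%MM.
  rewrite addmC submK //; apply/mnm_lepP => j; rewrite mulmnE mnm1E.
  by case: eqP => [<-|_]; rewrite ?mul1n ?mul0n.
have ek : (e <= k)%N by rewrite -mk mdegE (bigD1 i) //= (leq_trans em) // leq_addr.
rewrite ek; apply/memv_imgP; exists (hcomp (k - e) 'X_[m - U_(i) *+ e]); first exact: memvf.
rewrite mulhE val_hcomp; last first.
  rewrite dhomogX /=; move: mk; rewrite [in X in X -> _]mE mdegD mdegMn mdeg1 mul1n => <-.
  by rewrite addKn.
by rewrite mpolyXn -mpolyXD -mE.
Qed.

Lemma dim_power_gens k L : (k <= d)%N -> ('C(k + n, k) <= \dim (ideal_part k (power_gens L)) + card_below k L)%N.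
Proof.
move=> kd; rewrite -(dim_dhomog K).
pose s := [seq hcomp k 'X_[val m] : S k | m <- enum [set m : 'X_{1..n.+1 < d.+1} | below k L m]].
have sub : ({:S k} <= ideal_part k (power_gens L) + <<s>>)%VS.
  apply/subvP => u _; rewrite -(hcompK u) [val u]mpolyE raddf_sum big_seq /=.
  apply: rpred_sum => m mu; rewrite linearZ; apply: rpredZ.
  have mk : mdeg m = k by have /dhomogP h := dhomog_is_dhomog u; apply: h.
  have [ok|nok] := boolP (all (fun x => m x.1 < x.2)%N L); last first.
    exact: subvP (addvSl _ _) _ (mnm_in_ideal_part mk nok).
  have md : (mdeg m < d.+1)%N by rewrite mk.
  apply: subvP (addvSr _ _) _ _; apply: memv_span; apply/mapP; exists (BMultinom md) => //.
  by rewrite mem_enum inE /below /= mk eqxx.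
apply: leq_trans (dimvS sub) _.
have := dimv_sum_cap (ideal_part k (power_gens L)) <<s>>%VS => h.
apply: (leq_trans (leq_addr (\dim (ideal_part k (power_gens L) :&: <<s>>)) _)); rewrite h.
by rewrite leq_add2l (leq_trans (dim_span _)) // size_map -cardE.
Qed.

Lemma card_below_nil k : (k <= d)%N -> card_below k [::] = 'C(k + n, k).
Proof.
move=> kd; rewrite -(size_basis n k) /card_below cardE -(size_map val).
apply/perm_size/uniq_perm; [|exact: uniq_basis|].
  by rewrite map_inj_uniq ?enum_uniq //; apply: val_inj.
move=> m; rewrite -basis_cover; apply/mapP/idP => [[x]|mk].
  by rewrite mem_enum inE /below andbT => h ->.
have md : (mdeg m < d.+1)%N by rewrite (eqP mk).
by exists (BMultinom md) => //; rewrite mem_enum inE /below andbT.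
Qed.

(** The standard monomials divisible by [x_i^e] correspond, on dividing by it, to those of degree
    [k - e], because [L] does not constrain [x_i]. This is the recursion of [ci_hilb_cut]. *)
Lemma card_below_cons k i e L : (k <= d)%N -> i \notin map fst L ->
  card_below k L = (card_below k ((i, e) :: L) + delay (card_below^~ L) k e)%N.
Proof.
move=> kd iL; rewrite /card_below.
rewrite -(cardsID [set m : 'X_{1..n.+1 < d.+1} | (val m i < e)%N] [set m : 'X_{1..n.+1 < d.+1} | below k L m]).
congr (_ + _)%N; first by apply: eq_card => m; rewrite !inE /below /= andbA andbAC andbC.
rewrite delayE; case: leqP => ek; last first.
  apply/eqP; rewrite cards_eq0; apply/eqP/setP => m; rewrite !inE; apply/negP.
  case/andP; rewrite -leqNgt => em /andP[/eqP mk _]; move: ek; rewrite -mk ltnNge => /negP[].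
  by rewrite mdegE (bigD1 i) //= (leq_trans em) // leq_addr.
have bnd (m : 'X_{1..n.+1 < d.+1}) : (mdeg (m - U_(i) *+ e)%MM < d.+1)%N.
  by apply: leq_ltn_trans (mdegB _ _) (bmdeg m).
pose f m : 'X_{1..n.+1 < d.+1} := BMultinom (bnd m).
have lemE (m : 'X_{1..n.+1}) : (e <= m i)%N -> (U_(i) *+ e <= m)%MM.
  move=> em; apply/mnm_lepP => j; rewrite mulmnE mnm1E.
  by case: eqP => [<-|_]; rewrite ?mul1n ?mul0n.
rewrite -(card_in_imset (f := f)); last first.
  move=> x y; rewrite !inE => /andP[]; rewrite -leqNgt => ex _ /andP[]; rewrite -leqNgt => ey _.
  move/(congr1 val) => /= h; apply: val_inj; rewrite /= -(submK (lemE _ ex)) -(submK (lemE _ ey)).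
  by rewrite h.
apply: eq_card => m; rewrite [RHS]inE; apply/imsetP/idP.
  case=> x; rewrite !inE => /andP[]; rewrite -leqNgt => ex /andP[/eqP xk xL] ->.
  apply/andP; split.
    by rewrite /= -xk -[in X in _ == X](submK (lemE _ ex)) mdegD mdegMn mdeg1 mul1n addnK.
  apply/allP => -[j c] jL /=; rewrite mnmBE; apply: leq_ltn_trans (leq_subr _ _) _.
  exact: (allP xL) _ jL.
case/andP=> /eqP mk mL.
have md : (mdeg (m + U_(i) *+ e)%MM < d.+1)%N.
  by rewrite mdegD mdegMn mdeg1 mul1n mk subnK.
exists (BMultinom md); last by apply: val_inj; rewrite /= addmK.
rewrite !inE /= -leqNgt mnmDE mulmnE mnm1E eqxx mul1n leq_addl /=.
rewrite /below mdegD mdegMn mdeg1 mul1n mk subnK // eqxx /=.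
apply/allP => -[j c] jL /=; rewrite mnmDE mulmnE mnm1E.
case: eqP => [ij|_]; last by rewrite mul0n addn0; apply: (allP mL) _ jL.
by case/negP: iL; rewrite ij; apply/mapP; exists (j, c).
Qed.

Lemma card_below_ci_hilb k L : (k <= d)%N -> uniq (map fst L) ->
  card_below k L = ci_hilb (n.+1 - size L) (map snd L) k.
Proof.
elim: L k => [|[i e] L IH] k kd; first by rewrite card_below_nil // ci_hilb_nil subn0 addnS subn1.
move=> /= /andP[iL uL].
have szL : (size L < n.+1)%N.
  have := max_card (mem (i :: map fst L)); rewrite (card_uniqP _) /= ?iL //.
  by rewrite size_map card_ord.
have ME : (n.+1 - size L = (n.+1 - (size L).+1).+1)%N by lia.
have := card_below_cons e kd iL; rewrite IH // ME.
have -> : delay (card_below^~ L) k e = delay (ci_hilb (n.+1 - (size L).+1).+1 (map snd L)) k e.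
  by rewrite !delayE; case: leqP => // _; rewrite IH ?ME // (leq_trans (leq_subr _ _)).
by rewrite (ci_hilb_cut _ e) => /addIn <-.
Qed.

(** Exhibits a point at which the open condition holds. *)
Lemma generic_hilb_power_gens L : uniq (map fst L) -> generic_hilb d (power_gens L).
Proof.
move=> uL j k _ kd; rewrite /power_gens -map_drop size_map -map_comp /=.
have -> : [seq (fst \o (fun x : 'I_n.+1 * nat => (x.2, 'X_(x.1) ^+ x.2 : poly))) i | i <- drop j L] =
  map snd (drop j L) by apply: eq_map.
rewrite -card_below_ci_hilb //; first exact: dim_power_gens.
by rewrite map_drop drop_uniq.
Qed.

End Monomials.
End CI.

(** * Generic forms and their products with linear forms *)

Definition hmon m d := {x : 'X_{1..m < d.+1} | mdeg x == d}.

HB.instance Definition _ m d := Finite.on (hmon m d).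

Section Hmon.
Variable m : nat.

Definition mon_of d (x : hmon m d) : 'X_{1..m} := val (val x).

Lemma mdeg_mon_of d (x : hmon m d) : mdeg (mon_of x) = d.
Proof. by apply/eqP; case: x. Qed.

Lemma mon_of_inj d : injective (@mon_of d).
Proof. by move=> x y /val_inj /val_inj. Qed.

Lemma hmon_proof d (mu : 'X_{1..m}) (h : mdeg mu = d) : (mdeg mu < d.+1)%N.
Proof. by rewrite h. Qed.

Lemma hmon_proof2 d (mu : 'X_{1..m}) (h : mdeg mu = d) : mdeg (BMultinom (hmon_proof h)) == d.
Proof. exact/eqP. Qed.

Definition mk_hmon d mu (h : mdeg mu = d) : hmon m d := Sub (BMultinom (hmon_proof h)) (hmon_proof2 h).

Lemma mk_hmonK d mu (h : mdeg mu = d) : mon_of (mk_hmon h) = mu.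
Proof. by rewrite /mon_of SubK. Qed.

Lemma shift_proof d (j : 'I_m) (x : hmon m d) : mdeg (mon_of x + U_(j))%MM = d.+1.
Proof. by rewrite mdegD mdeg1 mdeg_mon_of addn1. Qed.

Definition shift d j (x : hmon m d) : hmon m d.+1 := mk_hmon (shift_proof j x).

Lemma mon_of_shift d j (x : hmon m d) : mon_of (shift j x) = (mon_of x + U_(j))%MM.
Proof. exact: mk_hmonK. Qed.

Lemma shift_ex d (x : hmon m d.+1) j : mon_of x j != 0%N -> exists y, x = shift j y.
Proof.
move=> xj; have dy : mdeg (mon_of x - U_(j))%MM = d.
  have := mdeg_mon_of x; rewrite -[in X in X -> _](@submK _ U_(j)%MM (mon_of x)) ?lep1mP //.
  by rewrite mdegD mdeg1 addn1 => -[].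
exists (mk_hmon dy); apply: mon_of_inj; rewrite mon_of_shift mk_hmonK submK //.
by rewrite lep1mP.
Qed.

Lemma mnm_neq0_ex d (x : hmon m d.+1) : exists j, mon_of x j != 0%N.
Proof.
apply/existsP; rewrite -negb_forall; apply/negP => /forallP x0.
have := mdeg_mon_of x; rewrite mdegE big1 // => j _; exact/eqP/x0.
Qed.
End Hmon.

Lemma card_hmon n d : #|{: hmon n.+1 d}| = 'C(d + n, d).
Proof.
rewrite -(size_basis n d) cardE -(size_map (@mon_of n.+1 d)).
apply/perm_size/uniq_perm; [|exact: uniq_basis|].
  by rewrite map_inj_uniq ?enum_uniq //; apply: mon_of_inj.
move=> mu; rewrite -basis_cover; apply/mapP/eqP => [[x _ ->]|h]; first exact: mdeg_mon_of.
by exists (mk_hmon h); rewrite ?mem_enum ?mk_hmonK.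
Qed.

Lemma card_hmon_support m d (J : {set 'I_m}) : (0 < #|J|)%N ->
  (#|[set x : hmon m d | [forall j, (j \notin J) ==> (mon_of x j == 0%N)]]| <= 'C(d + #|J| - 1, d))%N.
Proof.
move=> J0; set A := [set _ | _].
have JE : #|J| = (#|J|).-1.+1 by rewrite prednK.
have -> : (d + #|J| - 1 = d + (#|J|).-1)%N by rewrite -addnBA // subn1.
rewrite -card_hmon.
pose e (i : 'I_(#|J|).-1.+1) : 'I_m := enum_val (cast_ord (esym JE) i).
have deg x : x \in A -> mdeg [multinom mon_of x (e i) | i < (#|J|).-1.+1] = d.
  rewrite inE => /forallP xJ; rewrite -[RHS](mdeg_mon_of x) !mdegE.
  rewrite (bigID (mem J)) /= [X in (_ + X)%N]big1 ?addn0; last first.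
    by move=> j jJ; have := xJ j; rewrite jJ => /eqP.
  rewrite [RHS]big_enum_val /= (reindex (cast_ord JE)) /=; last first.
    by exists (cast_ord (esym JE)) => i _; rewrite ?cast_ordK ?cast_ordKV.
  by apply: eq_bigr => i _; rewrite mnmE /e cast_ordK.
pose f (x : {x | x \in A}) := mk_hmon (deg (val x) (valP x)).
suff inj_f : injective f by have := leq_card f inj_f; rewrite card_sig.
move=> x y /(congr1 (@mon_of _ _)); rewrite !mk_hmonK => /mnmP xy.
apply/val_inj/mon_of_inj/mnmP => j; have [jJ|jJ] := boolP (j \in J).
  have := xy (cast_ord JE (enum_rank_in jJ j)).
  by rewrite !mnmE /e cast_ordK enum_rankK_in.
have := valP x; have := valP y; rewrite !inE => /forallP/(_ j) yj /forallP/(_ j) xj.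
by move: xj yj; rewrite jJ => /eqP-> /eqP->.
Qed.

(** * Counting over a finite field *)

Lemma card_kermx_leq (F : finFieldType) D m (A : 'M[F]_(D, m)) :
  (#|[set v : 'rV[F]_D | (v *m A == 0)%R]| <= #|F| ^ (D - \rank A))%N.
Proof.
pose f (u : 'rV[F]_(\rank (kermx A))) := u *m row_base (kermx A).
have -> : (#|F| ^ (D - \rank A) = #|{: 'rV[F]_(\rank (kermx A))}|)%N.
  by rewrite card_mx mul1n mxrank_ker.
apply: leq_trans (leq_imset_card f _); apply/subset_leq_card/subsetP => v.
rewrite inE => /eqP /sub_kermxP vA; apply/imsetP.
have : (v <= row_base (kermx A))%MS by rewrite eq_row_base.
by case/submxP => u ->; exists u.
Qed.

Section Counting.
Variables (F : finFieldType) (m e r : nat).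
Local Notation q := #|F|.
Local Notation D := #|{: hmon m e}|.
Local Notation T := (hmon m e.+1).
Implicit Types (phi : {ffun T -> F}) (J : {set 'I_m}) (lam : {ffun 'I_m * 'I_m -> F}).

(* The catalecticant: row [j] is the functional [h |-> phi (x_j h)]. *)
Definition catmx phi : 'M[F]_(m, D) := \matrix_(j, k) phi (shift j (enum_val k)).

Definition row_relations J lam phi :=
  [forall j in ~: J, forall x : hmon m e,
     phi (shift j x) == \sum_(i in J) lam (j, i) * phi (shift i x)].

Definition relation_coefs J := [set lam : {ffun 'I_m * 'I_m -> F} | lam \in pffun_on 0 (setX (~: J) J) predT].

Lemma card_relation_coefs J : #|relation_coefs J| = (q ^ ((m - #|J|) * #|J|))%N.
Proof. by rewrite cardsE card_pffun_on cardsX cardsCs setCK card_ord. Qed.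

(** [J] indexes a maximal independent set of rows. It is nonempty for [phi != 0], since every
    monomial of degree [e.+1] is divisible by some variable and so its value appears in the
    matrix. *)
Lemma catmx_rank phi : exists J, [/\ #|J| = \rank (catmx phi),
  (phi == 0) || (0 < #|J|)%N & exists2 lam, lam \in relation_coefs J & row_relations J lam phi].
Proof.
set M := catmx phi; pose f := maxrankfun M.
pose J := [set f i | i : 'I_(\rank M)].
have cJ : #|J| = \rank M by rewrite card_imset ?card_ord //; apply: maxrankfun_inj.
exists J; split=> //.
  have [//|phi0] := boolP (phi == 0); rewrite /= cJ lt0n mxrank_eq0.
  apply: contra phi0 => /eqP M0; apply/eqP/ffunP => x; rewrite ffunE.
  have [j xj] := mnm_neq0_ex x; have [y ->] := shift_ex xj.
  have := congr1 (fun A : 'M[F]_(m, D) => A j (enum_rank y)) M0.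
  by rewrite !mxE enum_rankK.
have MJ : (M <= rowsub (enum_val : 'I_#|J| -> 'I_m) M)%MS.
  rewrite -(eq_maxrowsub M) -/f.
  have fJ i : f i \in J by apply: imset_f.
  have [r0|r0] := posnP (\rank M).
    by apply/row_subP => i; have := ltn_ord i; rewrite {2}r0.
  apply: (submx_rowsub (fun i => enum_rank_in (fJ (Ordinal r0)) (f i))) => i /=.
  by rewrite enum_rankK_in.
case/submxP: MJ => L ML.
have [J0|[i0 i0J]] := set_0Vmem J.
  exists [ffun=> 0].
    rewrite inE; apply/pffun_onP; split=> [|y _] //.
    by apply/subsetP => x; rewrite inE ffunE eqxx.
  apply/forall_inP => j _; apply/forallP => x; rewrite J0 big_set0.
  have := congr1 (fun A : 'M[F]_(m, D) => A j (enum_rank x)) ML.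
  rewrite mxE enum_rankK => ->; rewrite mxE; apply/eqP/big1 => i _.
  by have := ltn_ord i; rewrite {2}J0 cards0.
exists [ffun ji => if (ji.1 \notin J) && (ji.2 \in J) then L ji.1 (enum_rank_in i0J ji.2) else 0].
  rewrite inE; apply/pffun_onP; split=> [|y _] //.
  apply/subsetP => -[j i]; rewrite inE ffunE /= in_setX inE.
  by case: ifP => //; rewrite eqxx.
apply/forall_inP => j; rewrite inE => jJ; apply/forallP => x.
have := congr1 (fun A : 'M[F]_(m, D) => A j (enum_rank x)) ML.
rewrite mxE enum_rankK => ->; rewrite mxE; apply/eqP; rewrite [RHS]big_enum_val.
apply: eq_bigr => k _.
by rewrite ffunE /= jJ enum_valP !mxE enum_rankK enum_valK_in.
Qed.

(** Such a [phi] is determined by its values on monomials in the variables of [J]: a relation trades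
    a variable outside [J] for variables in [J], lowering the total exponent outside [J]. *)
Lemma card_rel J lam : (0 < #|J|)%N ->
  (#|[set phi | row_relations J lam phi]| <= q ^ 'C(e.+1 + #|J| - 1, e.+1))%N.
Proof.
move=> J0; pose A := [set x : T | [forall j, (j \notin J) ==> (mon_of x j == 0%N)]].
pose R phi : {ffun T -> F} := [ffun x => if x \in A then phi x else 0].
have injR : {in [set phi | row_relations J lam phi] &, injective R}.
  move=> p1 p2; rewrite !inE => r1 r2 /ffunP e12; apply/ffunP => x.
  have [k] := ubnP (\sum_(j in ~: J) mon_of x j)%N; elim: k x => // k IH x xk.
  have [xA|] := boolP (x \in A); first by have := e12 x; rewrite !ffunE xA.
  rewrite inE negb_forall => /existsP[j]; rewrite negb_imply => /andP[jJ xj].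
  have [y xE] := shift_ex xj.
  move: (r1) (r2) => /forall_inP/(_ j) h1 /forall_inP/(_ j) h2.
  rewrite inE in h1 h2; move/forallP: (h1 jJ) => /(_ y)/eqP g1; move/forallP: (h2 jJ) => /(_ y)/eqP g2.
  rewrite xE g1 g2; apply: eq_bigr => i iJ; congr (_ * _); apply: IH.
  rewrite ltnS in xk; apply: leq_trans xk; rewrite xE.
  rewrite (bigD1 j) ?inE //= [X in (_ < X)%N](bigD1 j) ?inE //= !mon_of_shift !mnmDE !mnm1E eqxx.
  rewrite (_ : (i == j) = false); last by apply/negbTE; apply: contraNneq jJ => <-.
  rewrite addn0 addn1 addSn ltnS leq_add2l.
  apply: leq_sum => l; rewrite inE => /andP[lJ lj]; rewrite !mnmDE !mnm1E leq_add2l.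
  by rewrite (_ : (i == l) = false) //; apply/negbTE; apply: contraNneq lJ => <-.
rewrite -(card_in_imset injR); apply: (@leq_trans #|pffun_on (0 : F) A predT|).
  apply/subset_leq_card/subsetP => _ /imsetP[p _ ->]; apply/pffun_onP; split=> [|y _] //.
  by apply/subsetP => x; rewrite inE ffunE; case: ifP => //; rewrite eqxx.
rewrite card_pffun_on leq_pexp2l ?card_hmon_support //.
by apply/card_gt0P; exists 0.
Qed.

(* Union bound over the [phi] killing all [x_j c_i], sorted by a basis [J] of the
   rows of the catalecticant; the factor [q - 1] is the number of multiples of
   each bad [phi]. *)
Lemma generic_forms : (2 ^ m < q.-1)%N ->
  (forall p, (0 < p <= m)%N -> 'C(e.+1 + p - 1, e.+1) + p * (m - p) <= r * p)%N ->
  exists c : {ffun 'I_r -> 'rV[F]_D}, forall phi,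
    (forall i, c i *m (catmx phi)^T = 0) -> phi = 0.
Proof.
move=> q2 hr.
pose kills (c : {ffun 'I_r -> 'rV[F]_D}) phi := [forall i, c i *m (catmx phi)^T == 0].
have [/existsP[c /forallP hc]|] := boolP [exists c, forall phi, kills c phi ==> (phi == 0)].
  exists c => phi h; apply/eqP; have := hc phi; rewrite (_ : kills c phi) //.
  by apply/forallP => i; rewrite h.
rewrite negb_exists => /forallP bad.
have {}bad c : {phi | kills c phi & phi != 0}.
  have : exists phi, kills c phi && (phi != 0).
    have := bad c; rewrite negb_forall => /existsP[phi]; rewrite negb_imply => h.
    by exists phi.
  by case/sigW => phi /andP[]; exists phi.
pose X := [set x : {ffun 'I_r -> 'rV[F]_D} * {ffun T -> F} | (x.2 != 0) && kills x.1 x.2].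
have catZ a phi : catmx [ffun x => a * phi x] = a *: catmx phi.
  by apply/matrixP => j k; rewrite !mxE ffunE.
have lower : (q ^ (r * D) * q.-1 <= #|X|)%N.
  pose g (x : {ffun 'I_r -> 'rV[F]_D} * {unit F}) : {ffun 'I_r -> 'rV[F]_D} * {ffun T -> F} :=
    (x.1, [ffun y => val x.2 * s2val (bad x.1) y]).
  have inj_g : injective g.
    move=> [c1 a1] [c2 a2] [<-]; case: (bad c1) => phi /= _ phi0 /ffunP h.
    congr (_, _); apply: val_inj; have [y yphi] : exists y, phi y != 0.
      apply/existsP; rewrite -negb_forall; apply: contra phi0 => /forallP h0.
      by apply/eqP/ffunP => y; rewrite ffunE; apply/eqP.
    by have := h y; rewrite !ffunE => /(mulIf yphi).
  have -> : (q ^ (r * D) * q.-1)%N = #|[set g x | x in setT]|.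
    have cu : #|{: {unit F}}| = q.-1 by rewrite -cardsT card_finField_unit.
    by rewrite card_imset // cardsT card_prod cu card_ffun card_mx mul1n card_ord -expnM [(D * r)%N]mulnC.
  apply/subset_leq_card/subsetP => _ /imsetP[[c a] _ ->]; rewrite inE /g /=.
  case: (bad c) => phi /= /forallP kphi phi0.
  have a0 : val a != 0 by rewrite -unitfE; apply: (valP a).
  apply/andP; split.
    apply: contra phi0 => /eqP/ffunP h; apply/eqP/ffunP => y; have := h y; rewrite !ffunE.
    by move/eqP; rewrite mulf_eq0 (negbTE a0) => /eqP.
  by apply/forallP => i; rewrite catZ linearZ /= -scalemxAr (eqP (kphi i)) scaler0.
have upper : (#|X| <= 2 ^ m * q ^ (r * D))%N.
  pose w J := (q ^ (r * (D - #|J|)))%N.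
  have XE : #|X| = (\sum_(phi : {ffun T -> F} | (phi != 0)%R) #|[set c | kills c phi]|)%N.
    rewrite -sum1_card (eq_bigl (fun x => (x.2 != 0) && (kills x.1 x.2))); last first.
      by move=> x; rewrite inE.
    rewrite -(pair_big_dep predT (fun c phi => (phi != 0) && kills c phi) (fun _ _ => 1%N)) /=.
    rewrite (exchange_big_dep (fun phi => phi != 0)) /=; last by move=> c phi _ /andP[].
    apply: eq_bigr => phi phi0; rewrite -[RHS]sum1_card; apply: eq_bigl => c.
    by rewrite inE phi0.
  have kc phi : (#|[set c | kills c phi]| <= q ^ (r * (D - \rank (catmx phi))))%N.
    have -> : #|[set c | kills c phi]| =
        #|(ffun_on [set v : 'rV[F]_D | v *m (catmx phi)^T == 0] : pred {ffun 'I_r -> _})|.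
      apply: eq_card => c; rewrite inE; apply/forallP/ffun_onP => h i; have := h i; by rewrite inE.
    rewrite card_ffun_on card_ord mulnC expnM -(mxrank_tr (catmx phi)).
    have := card_kermx_leq (catmx phi)^T; elim: (r) => // k IH h.
    by rewrite !expnS leq_mul // IH.
  rewrite XE; apply: (@leq_trans (\sum_(phi : {ffun T -> F} | (phi != 0)%R)
      \sum_(J : {set 'I_m} | 0 < #|J|) \sum_(lam in relation_coefs J)
         (if row_relations J lam phi && (#|J| == \rank (catmx phi)) then w J else 0))%N).
    apply: leq_sum => phi phi0; apply: leq_trans (kc phi) _.
    have [J [cJ]] := catmx_rank phi; rewrite (negbTE phi0) /= => J0 [lam lamJ rJ].
    by rewrite (bigD1 J) //= (bigD1 lam) //= rJ cJ eqxx /= /w cJ -addnA leq_addr.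
  rewrite exchange_big /=.
  have -> : (2 ^ m = \sum_(J : {set 'I_m}) 1)%N.
    by rewrite sum1_card -cardsT -powersetT card_powerset cardsT card_ord.
  rewrite big_distrl /= [X in (_ <= X)%N](bigID (fun J : {set 'I_m} => 0 < #|J|)%N) /=.
  apply: leq_trans (leq_addr _ _); apply: leq_sum => J J0; rewrite mul1n exchange_big /=.
  have [DJ|JD] := ltnP D #|J|.
    rewrite big1 // => lam _; rewrite big1 // => phi _; case: ifP => // /andP[_ /eqP h].
    by have := rank_leq_col (catmx phi); rewrite -h leqNgt DJ.
  apply: (@leq_trans (\sum_(lam in relation_coefs J) q ^ 'C(e.+1 + #|J| - 1, e.+1) * w J)%N).
    apply: leq_sum => lam _; rewrite -big_mkcondr /= sum_nat_const leq_mul2r; apply/orP; right.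
    apply: leq_trans (card_rel lam J0); apply/subset_leq_card/subsetP => phi.
    by rewrite !inE => /andP[_ /andP[]].
  (* With [p = #|J|] the exponents are [(m - p) p] for the relations, [C(e + p, e + 1)] for [phi]
     and [r (D - p)] for [c]; by [hr] they add up to at most [r D]. *)
  rewrite sum_nat_const card_relation_coefs /w -!expnD leq_pexp2l //; first by apply/card_gt0P; exists 0.
  have := hr #|J|; rewrite J0 -[X in (_ <= X)%N](card_ord m) max_card => /(_ isT).
  have -> : (r * D = r * (D - #|J|) + r * #|J|)%N by rewrite -mulnDr subnK.
  rewrite [(#|J| * _)%N]mulnC; move: (r * (D - _))%N (r * _)%N ('C(_, _)) ((m - _) * _)%N; lia.
have q0 : (0 < q ^ (r * D))%N by rewrite expn_gt0; apply/orP; left; apply/card_gt0P; exists 0.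
by have := leq_trans lower upper; rewrite mulnC leq_pmul2r // leqNgt q2.
Qed.
End Counting.

(** Divided by [p], the left side is [C(d + p - 1, d) / p + m - p], which is nondecreasing in [p],
    so the case [p = m] implies the others. The induction descends from there. *)
Lemma expected_count r m d : (3 <= d)%N -> ('C(d + m - 1, d) <= r * m)%N ->
  forall p, (0 < p <= m)%N -> ('C(d + p - 1, d) + p * (m - p) <= r * p)%N.
Proof.
move=> d3 hm p /andP[p0 pm].
suff H k : (k < m)%N -> ('C(d + (m - k) - 1, d) + (m - k) * (m - (m - k)) <= r * (m - k))%N.
  by have := H (m - p)%N; rewrite subKn //; apply; lia.
elim: k {pm p p0} => [_|k IH km]; first by rewrite subn0 subnn muln0 addn0.
  have [p [f0 f1]] : exists p, (m - k = p.+2)%N /\ (m - k.+1 = p.+1)%N.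
    by exists (m - k.+2)%N; split; lia.
  have g0 : (m - p.+2 = k)%N by lia.
  have g1 : (m - p.+1 = k.+1)%N by lia.
  have := IH (ltnW km); rewrite f0 g0 f1 g1 => h.
  have e1 : (d + p.+2 - 1 = (d + p).+1)%N by lia.
  have e2 : (d + p.+1 - 1 = d + p)%N by lia.
  rewrite e1 in h; rewrite e2.
  have h1 : (p.+1 * 'C((d + p).+1, d) = (d + p).+1 * 'C(d + p, d))%N.
    rewrite -[in LHS](bin_sub (_ : d <= (d + p).+1)%N); last by lia.
    rewrite -[in RHS](bin_sub (_ : d <= d + p)%N); last by lia.
    have -> : ((d + p).+1 - d = p.+1)%N by lia.
    have -> : (d + p - d = p)%N by lia.
    by rewrite -mul_bin_diag.
  have h2 : ('C(p.+2, 2) <= 'C(d + p, d))%N.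
    rewrite -[leqRHS](bin_sub (_ : d <= d + p)%N); last by lia.
    have -> : (d + p - d = p)%N by lia.
    rewrite -[leqLHS](bin_sub (_ : 2 <= p.+2)%N) // (_ : (p.+2 - 2 = p)%N); last by lia.
    by apply: leq_bin2l; lia.
  have h3 := bin2_double p.+2.
  move: ('C(d + p, d)) ('C((d + p).+1, d)) ('C(p.+2, 2)) h h1 h2 h3 => Y X c2 h h1 h2 h3.
  (* The monotonicity with denominators cleared: [(p+1) X - (p+2) Y = (d-1) Y >= 2 Y >= (p+2)(p+1)],
     using [d >= 3]. *)
  have h4 : (p.+2 * Y + p.+2 * p.+1 <= p.+1 * X)%N.
    rewrite h1; have [d' ->] : exists d', d = (d' + 3)%N by exists (d - 3)%N; lia.
    by rewrite (_ : ((d' + 3 + p).+1 * Y = p.+2 * Y + 2 * Y + d' * Y)%N); lia.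
  rewrite -(leq_pmul2l (ltn0Sn p.+1)).
  have := leq_mul (leqnn p.+1) h.
  rewrite mulnDr mulnA [(p.+1 * (r * _))%N]mulnCA mulnA.
  rewrite mulnDr !mulnA [(p.+2 * r)%N]mulnC -[(r * _ * _)%N]mulnA -[(r * _ * p.+1)%N]mulnA.
  rewrite [(p.+1 * p.+2)%N]mulnC mulnS; lia.
Qed.

(** * From a finite field to characteristic zero *)

Section Transfer.
Variables (m e r : nat).

(** Column [(i, j)] lists the coefficients of [x_j c_i]. The ring is arbitrary so that an integer
    matrix can be mapped both to a prime field and to [K]. *)
Definition apolarity_mx (R : comNzRingType) (c : 'I_r -> hmon m e -> R) :
    'M[R]_(#|{: hmon m e.+1}|, #|{: 'I_r * 'I_m}|) :=
  \matrix_(k, l) \sum_x c (enum_val l).1 x * (shift (enum_val l).2 x == enum_val k)%:R.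

Lemma apolarity_mxE (R : comNzRingType) (c : 'I_r -> hmon m e -> R) (phi : hmon m e.+1 -> R) l :
  ((\row_k phi (enum_val k)) *m apolarity_mx c) 0 l =
  \sum_x c (enum_val l).1 x * phi (shift (enum_val l).2 x).
Proof.
rewrite mxE; under eq_bigr => k _ do rewrite !mxE mulr_sumr.
rewrite exchange_big; apply: eq_bigr => x _ /=.
rewrite (bigD1 (enum_rank (shift (enum_val l).2 x))) //= enum_rankK eqxx mulr1.
rewrite big1 ?addr0 1?mulrC // => k kx; rewrite (_ : (_ == _) = false) ?mulr0 //.
by apply/negbTE; apply: contra kx => /eqP->; rewrite enum_valK.
Qed.

Lemma map_apolarity_mx (R R' : comNzRingType) (f : {rmorphism R -> R'}) c :
  map_mx f (apolarity_mx c) = apolarity_mx (fun i x => f (c i x)).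
Proof.
apply/matrixP => k l; rewrite !mxE rmorph_sum; apply: eq_bigr => x _.
by rewrite rmorphM rmorph_nat.
Qed.

(** Lift a right inverse modulo [p] to the integers: the product has determinant 1 modulo [p], hence
    a nonzero integer, which stays nonzero in [K]. *)
Lemma row_free_int_transfer p (K : fieldType) (charK0 : [pchar K] =i pred0) a b
    (A : 'M[int]_(a, b)) : prime p ->
  row_free (map_mx (intr : int -> 'F_p) A) -> row_free (map_mx (intr : int -> K) A).
Proof.
move=> pp /row_freeP[B AB]; apply/row_freeP.
pose B' := \matrix_(i, j) Posz (val (B i j)).
have BE : map_mx (intr : int -> 'F_p) B' = B.
  by apply/matrixP => i j; rewrite !mxE; apply: natr_Zp.
have d0 : \det (A *m B') != 0.
  apply/eqP => h; have := congr1 (intr : int -> 'F_p) h.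
  rewrite -det_map_mx map_mxM BE AB det1 => /eqP; by rewrite oner_eq0.
have u : map_mx (intr : int -> K) (A *m B') \in unitmx.
  rewrite unitmxE unitfE det_map_mx; move: d0; case: (\det _) => k.
    by rewrite /= -pmulrn natf_eq0.
  by move=> _; rewrite NegzE rmorphN oppr_eq0 /= -pmulrn (natf_eq0 charK0).
exists (map_mx intr B' *m invmx (map_mx intr (A *m B'))).
by rewrite mulmxA -map_mxM mulmxV.
Qed.

(* Dual form of the surjectivity in degree [e + 1] of the multiplication of [r]
   forms of degree [e] by linear forms. *)
Lemma hochster_laksov (K : fieldType) (charK0 : [pchar K] =i pred0) :
  (2 <= e)%N -> ('C(e.+1 + m - 1, e.+1) <= r * m)%N ->
  exists c : 'I_r -> hmon m e -> K, forall phi : hmon m e.+1 -> K,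
    (forall i j, \sum_x c i x * phi (shift j x) = 0) -> forall x, phi x = 0.
Proof.
move=> e2 hrm; have hp := expected_count (e2 : 3 <= e.+1)%N hrm.
(* The prime exceeds [2^m + 1] so that [p - 1 > 2^m], as the union bound requires. *)
have [p pm pp] := prime_above (2 ^ m).+1.
have q2 : (2 ^ m < #|{: 'F_p}|.-1)%N by rewrite card_Fp //; lia.
have [c hc] := generic_forms q2 hp.
pose cz i x := Posz (val (c i 0 (enum_rank x))).
have rf : row_free (map_mx (intr : int -> 'F_p) (apolarity_mx cz)).
  apply: inj_row_free => u uA.
  pose phi := [ffun x : hmon m e.+1 => u 0 (enum_rank x)].
  have uE : u = \row_k phi (enum_val k) by apply/rowP => k; rewrite mxE ffunE enum_valK.
  rewrite uE (hc phi); first by apply/rowP => k; rewrite !mxE ffunE.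
  move=> i; apply/rowP => j; rewrite !mxE.
  have := congr1 (fun A : 'rV__ => A 0 (enum_rank (i, j))) uA.
  rewrite uE map_apolarity_mx apolarity_mxE mxE enum_rankK /= => h; rewrite -[RHS]h.
  rewrite [RHS](reindex (enum_val : 'I_#|{: hmon m e}| -> hmon m e)) /=; last first.
    by exists enum_rank => ? _; rewrite ?enum_valK ?enum_rankK.
  apply: eq_bigr => k _; rewrite !mxE /cz enum_valK; congr (_ * _).
  by apply/esym/natr_Zp.
have {}rf := row_free_int_transfer charK0 pp rf.
exists (fun i x => intr (cz i x)) => phi h x.
have : (\row_k phi (enum_val k) : 'rV[K]_#|{: hmon m e.+1}|) = 0.
  apply: (row_free_inj rf); rewrite mul0mx; apply/rowP => l.
  by rewrite map_apolarity_mx apolarity_mxE mxE h.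
by move/rowP/(_ (enum_rank x)); rewrite !mxE enum_rankK.
Qed.
End Transfer.

(** * Sums of products of forms *)

Section Parametrization.
Variables (K : closedFieldType) (n d r : nat) (a : 'I_r -> nat).
Hypothesis a_le : forall i, (a i <= d)%N.
Local Notation S k := (dhomog n.+1 K k).
Local Notation poly := {mpoly K[n.+1]}.

(** The index [(i, s, m)] stands for the coefficient of the monomial [m] in [g_i] if [s] is false
    and in [h_i] if [s] is true. Monomials of the wrong degree are included and sent to 0 by
    [param_mon]. *)
Definition param : predArgType := ('I_r * bool * 'X_{1..n.+1 < d.+1})%type.

HB.instance Definition _ := Finite.on param.

Definition fdeg (i : 'I_r) (s : bool) : nat := (if s then d - a i else a i)%N.

Definition param_mon (i : 'I_r) (s : bool) (m : 'X_{1..n.+1}) : poly :=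
  if mdeg m == fdeg i s then 'X_[m] else 0.

(** Nonzero only for a monomial of [g_i] followed by one of [h_i], so that [quad param_mul] counts
    each product [g_i h_i] once. *)
Definition param_mul (s t : param) : S d :=
  if (s.1.1 == t.1.1) && ~~ s.1.2 && t.1.2
  then hcomp d (param_mon s.1.1 false s.2 * param_mon t.1.1 true t.2) else 0.

Definition factor (c : param -> K) (i : 'I_r) (s : bool) : poly :=
  \sum_(m : 'X_{1..n.+1 < d.+1}) c (i, s, m) *: param_mon i s m.

Definition coefs (g : 'I_r -> bool -> poly) (x : param) : K := (g x.1.1 x.1.2)@_(x.2).

Lemma fdeg_le i s : (fdeg i s <= d)%N.
Proof. by rewrite /fdeg; case: s; rewrite ?leq_subr ?a_le. Qed.

Lemma param_mon_homog i s m : param_mon i s m \is (fdeg i s).-homog.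
Proof. by rewrite /param_mon; case: eqP => [h|_]; rewrite ?dhomog0 // dhomogX /= h. Qed.

Lemma factor_homog c i s : factor c i s \is (fdeg i s).-homog.
Proof. by apply: rpred_sum => m _; apply/dhomogZ/param_mon_homog. Qed.

Lemma factor_coefs g i s : g i s \is (fdeg i s).-homog -> factor (coefs g) i s = g i s.
Proof.
move=> gh; have sz : (msize (g i s) <= d.+1)%N.
  rewrite msizeE; apply/bigmax_leqP_seq => m mg _; rewrite ltnS.
  by move/dhomogP: gh => /(_ m mg) ->; apply: fdeg_le.
rewrite [RHS](mpolywE sz); apply: eq_bigr => m _; rewrite /param_mon /coefs /=.
case: eqP => // /eqP h; rewrite (dhomog_nemf_coeff gh) ?scale0r //.
Qed.

Lemma factor_line c0 c1 t i s :
  factor (fun x => c0 x + t * (c1 x - c0 x)) i s =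
  factor c0 i s + t *: (factor c1 i s - factor c0 i s).
Proof.
rewrite /factor -sumrB scaler_sumr -big_split; apply: eq_bigr => m _ /=.
by rewrite scalerDl -scalerBl scalerA.
Qed.

Lemma sum_param (V : zmodType) (F : param -> V) :
  \sum_x F x = \sum_i \sum_m (F (i, false, m) + F (i, true, m)).
Proof.
transitivity (\sum_i \sum_s \sum_m F (i, s, m)).
  rewrite pair_big pair_big /=; apply: eq_bigr => -[[i s] m] //.
by apply: eq_bigr => i _; rewrite big_bool /= addrC -big_split.
Qed.

Lemma param_mul_sum c i m : \sum_t c t *: param_mul (i, false, m) t = hcomp d (param_mon i false m * factor c i true).
Proof.
rewrite sum_param (bigD1 i) //= [X in _ + X]big1 ?addr0; last first.
  move=> j ji; rewrite big1 // => m' _; rewrite /param_mul /= eq_sym (negbTE ji) !scaler0 addr0 //.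
rewrite /factor mulr_sumr linear_sum; apply: eq_bigr => m' _; rewrite /param_mul /= eqxx /=.
by rewrite scaler0 add0r -scalerAr linearZ.
Qed.

Lemma quad_param_mul c : quad param_mul c = hcomp d (\sum_i factor c i false * factor c i true).
Proof.
rewrite /quad sum_param linear_sum; apply: eq_bigr => i _.
rewrite [in RHS]/factor mulr_suml linear_sum; apply: eq_bigr => m _ /=.
rewrite [X in _ + X]big1 ?addr0; last by move=> t _; rewrite /param_mul /= andbF scaler0.
rewrite -scalerAl linearZ /= -param_mul_sum scaler_sumr /=.
by apply: eq_bigr => t _; rewrite scalerA.
Qed.

Lemma dquad_param_mul_l c i m : dquad param_mul c (i, false, m) = hcomp d (param_mon i false m * factor c i true).
Proof.
rewrite -param_mul_sum; apply: eq_bigr => t _; congr (_ *: _).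
by rewrite [X in _ + X]/param_mul /= andbF addr0.
Qed.

Lemma dquad_param_mul_r c i m : dquad param_mul c (i, true, m) = hcomp d (factor c i false * param_mon i true m).
Proof.
rewrite /dquad sum_param (bigD1 i) //= [X in _ + X]big1 ?addr0; last first.
  by move=> j ji; rewrite big1 // => m' _; rewrite /param_mul /= !andbF (negbTE ji) !addr0 !scaler0 addr0.
rewrite /factor mulr_suml linear_sum; apply: eq_bigr => m' _.
by rewrite /param_mul /= !andbF eqxx /= add0r addr0 scaler0 addr0 -scalerAl linearZ.
Qed.

Lemma dquad_line c0 c1 t x :
  dquad param_mul (fun x => c0 x + t * (c1 x - c0 x)) x =
  dquad param_mul c0 x + t *: (dquad param_mul c1 x - dquad param_mul c0 x).
Proof.
rewrite /dquad -sumrB scaler_sumr -big_split; apply: eq_bigr => y _ /=.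
by rewrite scalerDl -scalerBl scalerA.
Qed.

Definition factor_gens (s : bool) c : seq (nat * poly) := [seq (fdeg i s, factor c i s) | i <- enum 'I_r].

Lemma homogs_factor_gens s c : homogs (factor_gens s c).
Proof. by apply/allP => _ /mapP[i _ ->]; apply: factor_homog. Qed.

Lemma mem_ideal_part k (gs : seq (nat * poly)) e g u : (e, g) \in gs -> (e <= k)%N ->
  u \is (k - e)%N.-homog -> hcomp k (g * u) \in ideal_part k gs.
Proof.
elim: gs => //= [[e' g'] gs IH]; rewrite inE => /orP[/eqP[<- <-]|egs] ek uh; last first.
  exact: subvP (addvSr _ _) _ (IH egs ek uh).
apply: subvP (addvSl _ _) _ _; rewrite /= ek; apply/memv_imgP.
by exists (hcomp (k - e) u); rewrite ?memvf // mulhE val_hcomp.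
Qed.

(** The derivative in a coefficient of [g_i] is a monomial times [h_i], and conversely. *)
Lemma dquad_sub_ideal_part c :
  (<<[seq dquad param_mul c x | x <- enum param]>> <= ideal_part d (factor_gens true c ++ factor_gens false c))%VS.
Proof.
apply/span_subvP => _ /mapP[[[i s] m] _ ->].
have ad : (d - (d - a i) = a i)%N by rewrite subKn.
case: s; rewrite ?dquad_param_mul_l ?dquad_param_mul_r.
  apply: (mem_ideal_part (e := fdeg i false)); rewrite ?fdeg_le //; last exact: param_mon_homog.
  by rewrite mem_cat; apply/orP; right; apply/mapP; exists i; rewrite ?mem_enum.
rewrite mulrC; apply: (mem_ideal_part (e := fdeg i true)); rewrite ?fdeg_le //.
  by rewrite mem_cat; apply/orP; left; apply/mapP; exists i; rewrite ?mem_enum.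
by rewrite /= ad; exact: param_mon_homog.
Qed.

(** Each form of degree [e] in [hs] adds at most [H (d - e)] dimensions, because its multiples by
    the ideal of [gs] already lie in that ideal. *)
Lemma dim_ideal_part_cat (hs gs : seq (nat * poly)) (H : nat -> nat) :
  homogs hs -> homogs gs -> all (fun x => x.1 <= d)%N hs ->
  (forall k, (k <= d)%N -> (\dim (ideal_part k gs) + H k)%N = 'C(k + n, k)) ->
  (\dim (ideal_part d (hs ++ gs)) <= \dim (ideal_part d gs) + \sum_(x <- hs) H (d - x.1))%N.
Proof.
move=> hhs hgs + HE; elim: hs hhs => [|[e h] hs IH] /=; first by rewrite big_nil addn0.
case/andP=> hh /IH {}IH /andP[ed /IH {}IH]; rewrite ed big_cons /=.
have sub : (ideal_part d gs <= ideal_part d (hs ++ gs))%VS.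
  by elim: (hs) => [|x s IHs] /=; rewrite ?subvv // (subv_trans IHs) // addvSr.
have := dim_img_add (subv_trans (mulhom_ideal_part hh hgs ed) sub).
rewrite dim_dhomog -(HE _ (leq_subr e d)) addnCA addnC leq_add2l => h1.
by apply: leq_trans h1 _; rewrite [X in (_ <= X)%N]addnCA [X in (_ <= X)%N]addnC leq_add2r.
Qed.

End Parametrization.

(** * Few summands: sums of products are not dominant *)

Section NonDominance.
Variables (K : closedFieldType) (charK0 : [pchar K] =i pred0) (n d r : nat) (a : 'I_r -> nat).
Hypotheses (n1 : (1 <= n)%N) (d4 : (4 <= d)%N) (rn : (r <= n.+1)%N).
Hypotheses (a_pos : forall i, (0 < a i)%N) (a_half : forall i, (2 * a i <= d)%N).
Hypothesis r_small : (r * (n.+1 - r) < 'C(d + (n.+1 - r) - 1, d))%N.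
Local Notation poly := {mpoly K[n.+1]}.
Local Notation paramT := (param n d r).
Let m := (n.+1 - r)%N.
Let l := [seq a i | i <- enum 'I_r].

Let a_le i : (a i <= d)%N.
Proof. by have := a_half i; lia. Qed.

(** For [m = 0] the binomial in [r_small] is 0; for [m = 1] it is 1 while [r = n >= 1]. *)
Let m2 : (2 <= m)%N.
Proof.
rewrite /m; case E : (n.+1 - r)%N r_small => [|[|k]] //.
  by rewrite addn0 bin_small ?ltn0 //; lia.
by rewrite addnK binn; lia.
Qed.

Let iota1 (i : 'I_r) : 'I_n.+1 := widen_ord rn i.
(** These indices are in range and distinct when [2 r <= n.+1]. This is relied upon only in the
    exceptional case [r = 2], [n = 3]. *)
Let iota2 (i : 'I_r) : 'I_n.+1 := inord (r + i).

Let g1 (i : 'I_r) (s : bool) : poly :=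
  if s then 'X_(iota2 i) ^+ (d - a i) else 'X_(iota1 i) ^+ a i.

Let g1_homog i s : g1 i s \is (fdeg d a i s).-homog.
Proof. by rewrite /g1 /fdeg; case: s; rewrite mpolyXn dhomogX /= mdegMn mdeg1 mul1n. Qed.

Let c1 : paramT -> K := coefs g1.

Let line (c0 : paramT -> K) t : paramT -> K := fun x => c0 x + t * (c1 x - c0 x).

Let span_dquad (c : paramT -> K) := <<[seq dquad (param_mul K a) c x | x <- enum paramT]>>%VS.

Let trip (c0 : paramT -> K) s := [seq (fdeg d a i s, (factor a c0 i s, factor a c1 i s - factor a c0 i s)) | i <- enum 'I_r].

Let factor_gens_line (c0 : paramT -> K) s t : factor_gens a s (line c0 t) = map (line_pt t) (trip c0 s).
Proof. by rewrite -map_comp; apply: eq_map => i; rewrite /line_pt /= factor_line. Qed.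

Let size_factor_gens s (c : paramT -> K) : size (factor_gens a s c) = r.
Proof. by rewrite size_map size_enum_ord. Qed.

Let L s := [seq ((if s then iota2 i else iota1 i), fdeg d a i s) | i <- enum 'I_r].

Let factor_gens_line1 (c0 : paramT -> K) s : map (line_pt 1) (trip c0 s) = power_gens K (L s).
Proof.
rewrite /power_gens -!map_comp; apply: eq_map => i; rewrite /line_pt /= scale1r addrC subrK.
by rewrite factor_coefs // /g1; case: s.
Qed.

Let span_open (c0 : paramT -> K) : span_dquad c0 = fullv ->
  cofinitely (fun t => span_dquad (line c0 t) = fullv).
Proof.
move=> full; pose s := [seq (dquad (param_mul K a) c0 x, dquad (param_mul K a) c1 x - dquad (param_mul K a) c0 x) | x <- enum paramT].
have sE t : [seq x.1 + t *: x.2 | x <- s] = [seq dquad (param_mul K a) (line c0 t) x | x <- enum paramT].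
  by rewrite -map_comp; apply: eq_map => x; rewrite /= dquad_line.
have := dim_span_line s 0; apply: cofinitely_imp => t; rewrite !sE.
have -> : [seq dquad (param_mul K a) (line c0 0) x | x <- enum paramT] = [seq dquad (param_mul K a) c0 x | x <- enum paramT].
  by apply: eq_map => x; rewrite dquad_line scale0r addr0.
by rewrite -/(span_dquad c0) full => h; apply/eqP; rewrite eqEdim subvf.
Qed.

Let map_fst_factor_gens (c : paramT -> K) : map fst (factor_gens a false c) = l.
Proof. by rewrite -map_comp. Qed.

(* A full span at [c0] persists at a general point of the line through [c0] and [c1],
   where the first factors, or all factors in the exceptional case, form a complete
   intersection. *)
Lemma span_dquad_neq (c0 : paramT -> K) : span_dquad c0 <> fullv.
Proof.
move=> /span_open full.
have l1 : all (leq 1) l by apply/allP => _ /mapP[i _ ->].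
have l2 : all (fun x => 2 * x <= d)%N l by apply/allP => _ /mapP[i _ ->].
have sl : size l = r by rewrite size_map size_enum_ord.
have rl : (size l * m < 'C(d + m - 1, d))%N by rewrite sl.
have [ex|[d4E mE lE]] := ci_hilb_excess d4 m2 l1 l2 rl.
  have rich1 : generic_hilb d (map (line_pt 1) (trip c0 false)).
    rewrite factor_gens_line1; apply: generic_hilb_power_gens; rewrite -map_comp map_inj_uniq ?enum_uniq //.
    by move=> i j /(congr1 val) /= h; apply: val_inj.
  have [t [ft rt]] := cofinitely_ex charK0 (cofinitely_and full (generic_hilb_line rich1)).
  rewrite -factor_gens_line in rt; set c := line c0 t in ft rt.
  have hd k : (k <= d)%N -> (\dim (ideal_part k (factor_gens a false c)) + ci_hilb m l k)%N = 'C(k + n, k).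
    move=> kd; have := generic_hilb_dim (homogs_factor_gens a false c) _ rt kd.
    by rewrite size_factor_gens map_fst_factor_gens; apply.
  have hall : all (fun x : nat * poly => x.1 <= d)%N (factor_gens a true c).
    by apply/allP => _ /mapP[i _ ->]; apply: fdeg_le.
  have := dim_ideal_part_cat (homogs_factor_gens a true c) (homogs_factor_gens a false c) hall hd.
  rewrite big_map /= (eq_bigr (fun i => ci_hilb m l (a i))); last first.
    (* The second factor has degree [d - a i], so it adds at most the value at [a i]. *)
    by move=> i _; rewrite subKn.
  rewrite -(big_map a xpredT (ci_hilb m l)) -/l.
  have := dimvS (dquad_sub_ideal_part a_le c); rewrite -/(span_dquad c) ft dim_dhomog -(hd d) // => h1 h2.
  by have := leq_trans h1 h2; rewrite leq_add2l leqNgt; move: ex; rewrite /excess_pos => ->.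
have r2 : r = 2%N by rewrite -sl lE.
have n3 : n = 3%N by move: mE; rewrite /m r2; lia.
have ai i : a i = 2%N.
  have : a i \in l by apply: map_f; rewrite mem_enum.
  by rewrite lE !inE orbb => /eqP.
have i2 i : val (iota2 i) = (r + i)%N.
  by rewrite /= inordK //; have := ltn_ord i; lia.
have rich1 : generic_hilb d (map (line_pt 1) (trip c0 true ++ trip c0 false)).
  rewrite map_cat !factor_gens_line1 /power_gens -map_cat; apply: generic_hilb_power_gens.
  rewrite map_cat cat_uniq; apply/and3P; split.
  - rewrite -map_comp map_inj_uniq ?enum_uniq // => i j /= /(congr1 val).
    by rewrite !i2 => /addnI /val_inj.
  - apply/hasPn => _ /mapP[_ /mapP[i _ ->] ->]; apply/mapP => -[_ /mapP[j _ ->] /= /(congr1 val)].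
    by rewrite i2 /= => h; have := ltn_ord i; rewrite h; lia.
  - rewrite -map_comp map_inj_uniq ?enum_uniq // => i j /= /(congr1 val) /= h.
    exact: val_inj.
have [t [ft rt]] := cofinitely_ex charK0 (cofinitely_and full (generic_hilb_line rich1)).
rewrite map_cat -!factor_gens_line in rt; set c := line c0 t in ft rt.
have hc : homogs (factor_gens a true c ++ factor_gens a false c).
  by rewrite /homogs all_cat; apply/andP; split; apply: homogs_factor_gens.
have sc : size (factor_gens a true c ++ factor_gens a false c) = n.+1.
  by rewrite size_cat !size_factor_gens; lia.
have h3 := generic_hilb_dim hc (eq_leq sc) rt (leqnn d); rewrite sc subnn in h3.
have h1 := dimvS (dquad_sub_ideal_part a_le c); rewrite -/(span_dquad c) ft dim_dhomog -h3 in h1.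
have fE : map fst (factor_gens a true c ++ factor_gens a false c) = [:: 2; 2; 2; 2]%N.
  rewrite map_cat map_fst_factor_gens lE -/([:: 2; 2] ++ [:: 2; 2])%N; congr (_ ++ _).
  by rewrite -lE -map_comp; apply: eq_map => i; rewrite /= ai d4E.
(* The coefficient of [t^4] in [(1 + t)^4]: the four quadrics miss one dimension in degree 4. *)
have hf1 : ci_hilb 0 [:: 2; 2; 2; 2]%N d = 1%N.
  by rewrite d4E; do 4![rewrite !ci_hilb_consE !big_ord_recl !big_ord0 !delayE /=]; rewrite !ci_hilb_nil.
by move: h1; rewrite fE hf1 addn1 ltnn.
Qed.

Lemma strength_type_avoidable :
  exists2 P : {mpoly K[\dim {: dhomog n.+1 K d}]}, P != 0 &
    forall (f : dhomog n.+1 K d) (g : 'I_r -> bool -> poly),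
      (forall i s, g i s \is (fdeg d a i s).-homog) ->
      val f = \sum_i g i false * g i true -> P.@[vcoords f] = 0.
Proof.
have [P P0 hP] := quad_not_dominant charK0 (@span_dquad_neq).
exists P => // f g gh fE; rewrite -(hP (coefs g)) quad_param_mul; congr (_.@[vcoords _]).
rewrite -(hcompK f) fE; congr hcomp; apply: eq_bigr => i _.
by rewrite !factor_coefs.
Qed.

End NonDominance.

(** * Many summands: multiples of linear forms are dominant *)

Section SliceDominance.
Variables (K : closedFieldType) (charK0 : [pchar K] =i pred0) (n e r : nat).
Hypotheses (e2 : (2 <= e)%N) (rn : (r <= n.+1)%N).
Let m := (n.+1 - r)%N.
Hypothesis r_large : ('C(e.+1 + m - 1, e.+1) <= r * m)%N.
Local Notation d := e.+1.
Local Notation poly := {mpoly K[n.+1]}.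
Local Notation paramT := (param n d r).
Let a (i : 'I_r) := 1%N.

Let a_le i : (a i <= d)%N. Proof. by []. Qed.

(** The first [m] variables carry the forms of degree [e]; the last [r], given by [vr], are the
    linear forms. *)
Let vl (j : 'I_m) : 'I_n.+1 := widen_ord (leq_subr r n.+1) j.
Let vr (i : 'I_r) : 'I_n.+1 := inord (m + i).

Let vrE i : val (vr i) = (m + i)%N.
Proof. by rewrite /= inordK //; have := ltn_ord i; rewrite /m; lia. Qed.

Let emb (mu : 'X_{1..m}) : 'X_{1..n.+1} :=
  [multinom oapp mu 0%N (insub (i : nat) : option 'I_m) | i < n.+1].

Let embD mu nu : emb (mu + nu)%MM = (emb mu + emb nu)%MM.
Proof.
apply/mnmP => i; rewrite mnmDE !mnmE; case: insubP => [j _ _|_] //=.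
by rewrite mnmDE.
Qed.

Let embU j : emb U_(j)%MM = U_(vl j)%MM.
Proof.
apply/mnmP => i; rewrite mnm1E mnmE; case: insubP => [k _ ki|im] /=.
  by rewrite mnm1E; congr nat_of_bool; rewrite -!val_eqE /= ki.
rewrite (_ : (vl j == i) = false) //; apply/negbTE; apply: contra im => /eqP <-.
by rewrite /= ltn_ord.
Qed.

Let mdeg_emb mu : mdeg (emb mu) = mdeg mu.
Proof.
have E0 : emb 0%MM = 0%MM by apply/mnmP => i; rewrite mnmE mnm0E; case: insub => //= j; rewrite mnm0E.
have ES p q : emb (p + q)%MM = (emb p + emb q)%MM := embD p q.
rewrite {1}[mu]multinomUE_id (big_morph emb ES E0) mdeg_sum mdegE; apply: eq_bigr => j _.
have EM k : emb (U_(j) *+ k)%MM = (U_(vl j) *+ k)%MM.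
  by elim: k => [|k IH]; rewrite ?mulm0n // !mulmS embD IH embU.
by rewrite EM mdegMn mdeg1 mul1n.
Qed.

Let emb_surj (nu : 'X_{1..n.+1}) : (forall i, nu (vr i) = 0%N) ->
  emb [multinom nu (vl j) | j < m] = nu.
Proof.
move=> nu0; apply/mnmP => i; rewrite mnmE; case: insubP => [k _ ki|im] /=.
  by rewrite mnmE; congr (nu _); apply: val_inj; rewrite /= -ki.
have ir : (i - m < r)%N by have := ltn_ord i; rewrite /m in im *; lia.
rewrite -(nu0 (Ordinal ir)); congr (nu _); apply: val_inj; rewrite vrE /=.
by rewrite subnKC // leqNgt.
Qed.

Lemma slice_surjective : exists c : paramT -> K,
  <<[seq dquad (param_mul K a) c x | x <- enum paramT]>>%VS = fullv.
Proof.
have [cf hcf] := hochster_laksov charK0 e2 r_large.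
pose g (i : 'I_r) (s : bool) : poly :=
  if s then \sum_(x : hmon m e) cf i x *: 'X_[emb (mon_of x)] else 'X_(vr i).
have gh i s : g i s \is (fdeg d a i s).-homog.
  rewrite /g /fdeg /a; case: s; last by rewrite dhomogX /= mdeg1.
  apply: rpred_sum => x _; apply: rpredZ.
  by rewrite dhomogX /= mdeg_emb mdeg_mon_of subn1.
pose c := coefs g : paramT -> K; exists c.
have fc i s : factor a c i s = g i s by apply: factor_coefs.
(* The coordinates of [pr] are functionals vanishing on [U]; showing [pr = 0] on monomials proves
   that [U] is everything. *)
set U := <<_>>%VS; pose pr := (\1 - projv U)%VF.
have prU u : u \in U -> pr u = 0.
  by move=> uU; rewrite add_lfunE opp_lfunE id_lfunE projv_id // subrr.
have inU (x : paramT) : dquad (param_mul K a) c x \in U by apply/memv_span/map_f; rewrite mem_enum.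
have bm (mu : 'X_{1..n.+1}) : (mdeg mu <= d)%N -> (mdeg mu < d.+1)%N by [].
have prmon (nu : 'X_{1..n.+1}) : mdeg nu = d -> pr (hcomp d 'X_[nu]) = 0.
  move=> dnu; have [/existsP[i nui]|] := boolP [exists i, nu (vr i) != 0%N].
    (* A monomial divisible by the linear form [x_(vr i)] is a derivative in a coefficient of its
       cofactor. *)
    apply: prU; have dm : mdeg (nu - U_(vr i))%MM = e.
      move: dnu; rewrite -[in X in X -> _](@submK _ U_(vr i)%MM nu) ?lep1mP //.
      by rewrite mdegD mdeg1 addn1 => -[].
    have := inU (i, true, BMultinom (bm _ (leqW (eq_leq dm)))).
    rewrite (dquad_param_mul_r a c) fc /g /param_mon /fdeg /= /a dm subn1 eqxx.
    by rewrite -mpolyXD addmC submK // lep1mP.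
  rewrite negb_exists => /forallP nu0.
  have nuE : emb [multinom nu (vl j) | j < m] = nu.
    by apply: emb_surj => i; apply/eqP; have := nu0 i; rewrite negbK.
  have dnu' : mdeg [multinom nu (vl j) | j < m] = d by rewrite -mdeg_emb nuE.
  have fb := vbasisP {: dhomog n.+1 K d}.
  pose phi k (x : hmon m d) := coord (vbasis {: dhomog n.+1 K d}) k (pr (hcomp d 'X_[emb (mon_of x)])).
  have phi0 k x : phi k x = 0.
    apply: hcf => i j; rewrite /phi.
    have d1 : mdeg U_(vl j)%MM = 1%N by rewrite mdeg1.
    (* The derivative in the coefficient of [x_(vl j)] in the [i]-th linear form is [x_(vl j)] times
       its cofactor, so [phi] satisfies the hypothesis of [hcf]. *)
    have := inU (i, false, BMultinom (bm _ (leq_trans (eq_leq d1) (ltn0Sn e)))).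
    rewrite (dquad_param_mul_l a c) fc /g /param_mon /fdeg /= /a mdeg1 eqxx => /prU h.
    rewrite -[RHS](linear0 (coord (vbasis {: dhomog n.+1 K d}) k)) -[in RHS]h.
    rewrite mulr_sumr !linear_sum; apply: eq_bigr => y _ /=.
    rewrite mon_of_shift embD embU mpolyXD ['X_[emb _] * _]mulrC -scalerAr.
    by rewrite 3!linearZ.
  rewrite -nuE -(mk_hmonK dnu') (coord_basis fb (memvf (pr _))) big1 // => k _.
  by rewrite -/(phi _ _) phi0 scale0r.
apply/eqP; rewrite eqEsubv subvf; apply/subvP => v _.
have pv : pr v = 0.
  rewrite -(hcompK v) [val v]mpolyE !linear_sum big_seq big1 // => mu muv /=.
  rewrite !linearZ /= prmon ?scaler0 //.
  by have /dhomogP h := dhomog_is_dhomog v; apply: h.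
have : v = projv U v.
  by move: pv; rewrite add_lfunE opp_lfunE id_lfunE => /eqP; rewrite subr_eq0 => /eqP.
by move=> ->; apply: memv_proj.
Qed.

Lemma slice_dominant :
  exists2 P : {mpoly K[\dim {: dhomog n.+1 K d}]}, P != 0 &
    forall f : dhomog n.+1 K d, P.@[vcoords f] != 0 -> slice_decomposition f r.
Proof.
have [c full] := slice_surjective; have [P P0 hP] := quad_dominant charK0 full.
exists P => // f /hP[c' fE]; exists (fun i => factor a c' i false), (fun i => factor a c' i true).
split=> [i|i|]; [exact: (factor_homog a c' i false)| |].
  by have := factor_homog a c' i true; rewrite /fdeg /a subn1.
rewrite -fE quad_param_mul; rewrite -[LHS]/(val (hcomp _ _)) val_hcomp //.
apply: rpred_sum => i _.
by apply: (dhomogM_eq (factor_homog a c' i false) (factor_homog a c' i true)); rewrite /fdeg /a subn1.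
Qed.
End SliceDominance.

(** * Comparison of strength and slice rank *)

Section Main.
Variables (K : closedFieldType) (charK0 : [pchar K] =i pred0) (n d : nat).
Local Notation S := (dhomog n.+1 K d).
Local Notation poly := {mpoly K[n.+1]}.

Lemma slice_strength (f : S) s : (2 <= d)%N -> slice_decomposition f s -> strength_decomposition f s.
Proof.
move=> d2 [l [h [l1 hd fE]]]; exists l, h; split=> // i; first by exists 1%N.
by exists d.-1 => //; lia.
Qed.

(* Summands of degree other than [d] cancel, and are dropped. *)
Lemma strength_normal_form (f : S) s : (2 <= d)%N -> strength_decomposition f s ->
  exists (a : {ffun 'I_s -> 'I_d.+1}) (g : 'I_s -> bool -> poly),
    [/\ forall i, (0 < a i)%N, forall i, (2 * a i <= d)%N,
        forall i t, g i t \is (fdeg d (fun i => a i : nat) i t).-homog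
      & val f = \sum_i g i false * g i true].
Proof.
move=> d2 [g [h [gh hh fE]]].
have H i : exists x : 'I_d.+1 * (bool -> poly), [/\ (0 < x.1)%N, (2 * x.1 <= d)%N,
    forall t, x.2 t \is (if t then d - x.1 else x.1)%N.-homog
    & pihomog mdeg d (g i * h i) = x.2 false * x.2 true].
  have [j j0 gj] := gh i; have [k k0 hk] := hh i.
  have [jk|jk] := eqVneq (j + k)%N d; last first.
    have d1 : (1 < d.+1)%N by lia.
    (* A dropped product is recorded as a product of zero forms of degrees 1 and [d - 1]. *)
    exists (Ordinal d1, fun=> 0); split=> //=; first by move=> t; apply: dhomog0.
    by rewrite mulr0 (pihomog_ne0 jk) // dhomogM.
  have pE : pihomog mdeg d (g i * h i) = g i * h i by apply/pihomog_dE/(dhomogM_eq gj hk).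
  have jd : (j < d.+1)%N by lia.
  have kd : (k < d.+1)%N by lia.
  have [j2|j2] := leqP (2 * j) d.
    exists (Ordinal jd, fun t => if t then h i else g i); split=> //=.
    by case=> //; rewrite (_ : (d - j = k)%N) //; lia.
  exists (Ordinal kd, fun t => if t then g i else h i); split=> //=; [lia| |by rewrite pE mulrC].
  by case=> //; rewrite (_ : (d - k = j)%N) //; lia.
have [x hx] := fin_all_exists H.
exists [ffun i => (x i).1], (fun i => (x i).2); split=> [i|i|i t|].
- by rewrite ffunE; have [] := hx i.
- by rewrite ffunE; have [] := hx i.
- by rewrite /fdeg ffunE; have [_ _ h3 _] := hx i; apply: h3.
have -> : val f = pihomog mdeg d (val f) by rewrite (pihomog_dE (dhomog_is_dhomog f)).
rewrite [val f]fE linear_sum; apply: eq_bigr => i _.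
by have [] := hx i.
Qed.

(** In the normal form [0 < 2 a <= 3] forces [a = 1]. *)
Lemma strength_slice_small (f : S) s : (2 <= d <= 3)%N ->
  strength_decomposition f s -> slice_decomposition f s.
Proof.
case/andP=> d2 d3 /(strength_normal_form d2)[a [g [a0 a2 gh fE]]].
exists (fun i => g i false), (fun i => g i true).
have a1 i : (a i : nat) = 1%N by have := a0 i; have := a2 i; lia.
split=> // i; first by have := gh i false; rewrite /fdeg a1.
by have := gh i true; rewrite /fdeg a1 subn1.
Qed.

(** There are finitely many degree types, each confined to a hypersurface; the product of the
    equations covers all of them. *)
Lemma strength_avoidable s : (1 <= n)%N -> (4 <= d)%N -> (s <= n.+1)%N ->
  (s * (n.+1 - s) < 'C(d + (n.+1 - s) - 1, d))%N ->
  exists2 P : {mpoly K[\dim {: S}]}, P != 0 &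
    forall f : S, strength_decomposition f s -> P.@[vcoords f] = 0.
Proof.
move=> n1 d4 sn lt.
have H (a : {ffun 'I_s -> 'I_d.+1}) : exists P : {mpoly K[\dim {: S}]}, P != 0 /\
    ((forall i, (0 < a i)%N) -> (forall i, (2 * a i <= d)%N) ->
     forall (f : S) (g : 'I_s -> bool -> poly),
      (forall i t, g i t \is (fdeg d (fun i => a i : nat) i t).-homog) ->
      val f = \sum_i g i false * g i true -> P.@[vcoords f] = 0).
  have [/andP[/forallP a0 /forallP a2]|na] :=
      boolP ([forall i, 0 < a i] && [forall i, 2 * a i <= d])%N.
    by have [P P0 hP] := strength_type_avoidable charK0 n1 d4 sn a0 a2 lt; exists P.
  exists 1; split; first exact: oner_neq0.
  by move=> a0 a2; case/negP: na; apply/andP; split; apply/forallP.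
have [P hP] := fin_all_exists H.
exists (\prod_a P a); first by apply/prodf_neq0 => a _; have [] := hP a.
move=> f /(strength_normal_form (ltnW (ltnW d4)))[a [g [a0 a2 gh fE]]].
have [_ h] := hP a; rewrite rmorph_prod (bigD1 a) //=.
by rewrite (h a0 a2 f g gh fE) mul0r.
Qed.

Lemma zariski_open_nonzero (V : vectType K) (P : {mpoly K[\dim {:V}]}) :
  zariski_open (fun v : V => P.@[vcoords v] != 0).
Proof.
exists (fun Q => Q = P) => v; split=> [/eqP Pv /(_ P erefl)//|nz].
by apply/eqP => Pv; apply: nz => _ ->.
Qed.

Lemma nonzero_ex (V : vectType K) (P : {mpoly K[\dim {:V}]}) : P != 0 ->
  exists v : V, P.@[vcoords v] != 0.
Proof.
move=> /(mpoly_nonroot charK0)[w wP].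
exists (\sum_i w i *: (vbasis {:V})`_i); rewrite (meval_eq (v2 := w)) // => i.
by rewrite /vcoords coord_sum_free ?(basis_free (vbasisP _)).
Qed.
End Main.

Theorem corollary1p9 (K : closedFieldType) (charK0 : [pchar K] =i pred0)
    (n d : nat) (n_ge1 : (1 <= n)%N) (d_ge2 : (2 <= d)%N) :
  exists U : dhomog n.+1 K d -> Prop,
    [/\ zariski_open U,
        exists f, U f
      & forall f, U f -> strength f = slice_rank f].
Proof.
have rk (f : dhomog n.+1 K d) : is_least (strength_decomposition f) (strength f) /\
    is_least (slice_decomposition f) (slice_rank f).
  by split; [apply: strengthP|apply/slice_rankP/ltnW].
have [d3|d4] := leqP d 3.
  (* The open set is the whole space, cut out by the constant 1. *)
  exists (fun v => (1 : {mpoly K[\dim {: dhomog n.+1 K d}]}).@[vcoords v] != 0); split.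
  - exact: zariski_open_nonzero.
  - by apply: nonzero_ex => //; apply: oner_neq0.
  move=> f _; have [[st stm] [sl slm]] := rk f.
  apply/eqP; rewrite eqn_leq stm /=; last exact: slice_strength.
  by apply: slm; apply: strength_slice_small => //; rewrite d_ge2.
pose ok r := (r <= n.+1)%N && ('C(d + (n.+1 - r) - 1, d) <= r * (n.+1 - r))%N.
have ex_ok : exists r, ok r.
  (* For [r = n.+1] both sides vanish, since [C(d - 1, d) = 0]. *)
  by exists n.+1; rewrite /ok leqnn subnn addn0 bin_small //; lia.
case: (ex_minnP ex_ok) => r0 /andP[r0n r0ok] r0min.
have [e eE] : exists e, d = e.+1 by exists d.-1; lia.
have [P0 P00 hP0] : exists2 P : {mpoly K[\dim {: dhomog n.+1 K d}]}, P != 0 &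
    forall f : dhomog n.+1 K d, P.@[vcoords f] != 0 -> slice_decomposition f r0.
  clear -charK0 d4 r0n r0ok eE; subst d.
  by apply: (slice_dominant charK0 (ltnW (_ : 2 < e)%N) r0n r0ok).
have av (s : 'I_r0) : exists P : {mpoly K[\dim {: dhomog n.+1 K d}]}, P != 0 /\
    forall f : dhomog n.+1 K d, strength_decomposition f s -> P.@[vcoords f] = 0.
  have sn : (s <= n.+1)%N by apply: leq_trans (ltnW (ltn_ord s)) r0n.
  (* By minimality of [r0], every smaller [s] fails [ok]. *)
  have lt : (s * (n.+1 - s) < 'C(d + (n.+1 - s) - 1, d))%N.
    rewrite ltnNge; apply/negP => le.
    by have := r0min s; rewrite /ok sn le leqNgt ltn_ord => /(_ isT).
  by have [P Pn hP] := strength_avoidable charK0 n_ge1 d4 sn lt; exists P.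
have [P hP] := fin_all_exists av.
exists (fun v => (P0 * \prod_s P s).@[vcoords v] != 0); split.
- exact: zariski_open_nonzero.
- apply: nonzero_ex => //; rewrite mulf_neq0 //; apply/prodf_neq0 => s _.
  by have [] := hP s.
move=> f; rewrite mevalM mulf_eq0 => /norP[/hP0 sl0 nP].
have [[st stm] [sl slm]] := rk f.
have le1 : (strength f <= slice_rank f)%N by apply/stm/slice_strength.
have le2 := slm _ sl0.
(* The slice rank is at most [r0]; a strength below [r0] would place [f] on one of the excluded
   hypersurfaces. *)
apply/eqP; rewrite eqn_leq le1 /=; apply: leq_trans le2 _; rewrite leqNgt; apply/negP => lt.
have [_ h] := hP (Ordinal lt); case/negP: nP.
by rewrite rmorph_prod (bigD1 (Ordinal lt)) //= h // mul0r.
Qed.
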